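(* Let $A$ be an abelian group, and let $\widehat A$ be its profinite completion. The following conditions are equivalent: (i) $\widehat A$ is topologically Hopfian; (ii) $A/pA$ is finite for every prime $p$; (iii) for every prime $p$, the Sylow pro-$p$ subgroup of $\widehat A$ is topologically finitely generated.
   Context: The profinite completion of an abelian group $A$ is the profinite group $\widehat A=\varprojlim_{N\le A,\ [A:N]<\infty}A/N$ (inverse limit of the finite discrete quotients, with the inverse limit topology). A topological group is topologically Hopfian if every continuous surjective endomorphism of it is injective. A profinite group is topologically finitely generated if it has a dense finitely generated subgroup. An abelian profinite group is the direct product of its Sylow pro-$p$ subgroups, exactly one for each prime $p$; the Sylow pro-$p$ subgroup of $\widehat A$ identifies with the pro-$p$ completion $\widehat A_p=\varprojlim_{N\le A,\ [A:N]\text{ a power of }p}A/N$. *)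

(* Defs.v *)
From HB Require Import structures.
From mathcomp Require Import all_boot all_order all_algebra.
From mathcomp Require Import all_classical topology tvs.

Set Implicit Arguments.
Unset Strict Implicit.
Unset Printing Implicit Defensive.

Import GRing.Theory.

Local Open Scope classical_set_scope.
Local Open Scope card_scope.
Local Open Scope ring_scope.
Local Open Scope quotient_scope.

Notation "{ 'quot' I }" := (Quotient.quot I) : type_scope.

(* A subgroup of [A : zmodType] is a term of type [zmodClosed A]; its underlying
   predicate is boolean, but since the development is classical every subset is
   the extension of such a predicate. *)

Section Index.
Variables (A : zmodType) (N : zmodClosed A).

Definition finite_index : Prop := finite_set [set: {quot N}].

Definition has_index (n : nat) : Prop := [set: {quot N}] #= `I_n.

End Index.

Section Multiples.
Variables (A : zmodType) (p : nat).

Definition multiples : {pred A} := fun a => `[< exists b : A, a = b *+ p >].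

Lemma multiples_zmod_closed : zmod_closed multiples.
Proof.
split=> [|x y]; first by apply/asboolP; exists 0; rewrite mul0rn.
move=> /asboolP[b ->] /asboolP[c ->]; apply/asboolP; exists (b - c).
by rewrite mulrnBl.
Qed.

HB.instance Definition _ := GRing.isZmodClosed.Build A multiples
  multiples_zmod_closed.

End Multiples.
Arguments multiples : clear implicits.

Section DiscreteZmodule.
Variable T : zmodType.

HB.instance Definition _ := GRing.Zmodule.copy (discrete_topology T) T.

Lemma discrete_sub_continuous :
  continuous (fun x : discrete_topology T * discrete_topology T => x.1 - x.2).
Proof.
move=> [x y] U /= /nbhs_singleton Uxy.
exists ([set x], [set y]) => /=; last by move=> [a b] [/= -> ->].
by split; exact: discrete_set1.
Qed.

HB.instance Definition _ := PreTopologicalNmodule_isTopologicalZmodule.Build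
  (discrete_topology T) discrete_sub_continuous.

End DiscreteZmodule.

Section ProductZmodule.
Variables (I : eqType) (T : I -> topologicalZmodType).

Definition prod_group : Type := prod_topology T.

HB.instance Definition _ := Topological.on prod_group.

Implicit Types x y z : prod_group.

Definition prod_group_zero : prod_group := fun i => 0.
Definition prod_group_opp x : prod_group := fun i => - x i.
Definition prod_group_add x y : prod_group := fun i => x i + y i.

Fact prod_group_addA : associative prod_group_add.
Proof. by move=> x y z; apply: functional_extensionality_dep => i; exact: addrA. Qed.

Fact prod_group_addC : commutative prod_group_add.
Proof. by move=> x y; apply: functional_extensionality_dep => i; exact: addrC. Qed.

Fact prod_group_add0 : left_id prod_group_zero prod_group_add.
Proof. by move=> x; apply: functional_extensionality_dep => i; exact: add0r. Qed.

Fact prod_group_addN : left_inverse prod_group_zero prod_group_opp prod_group_add.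
Proof. by move=> x; apply: functional_extensionality_dep => i; exact: addNr. Qed.

HB.instance Definition _ := GRing.isZmodule.Build prod_group
  prod_group_addA prod_group_addC prod_group_add0 prod_group_addN.

Lemma prod_group_sub_continuous :
  continuous (fun x : prod_group * prod_group => x.1 - x.2).
Proof.
have proj_cont i : continuous (fun x : prod_group => x i).
  exact: (@proj_continuous I T i).
move=> u; apply/cvg_sup => i.
have h : continuous (fun w : prod_group * prod_group => w.1 i - w.2 i).
  move=> w; apply: (@continuous_comp _ _ _
    (fun w : prod_group * prod_group => (w.1 i, w.2 i))
    (fun x : T i * T i => x.1 - x.2)); last exact: sub_continuous.
  apply: cvg_pair.
    exact: (@continuous_comp _ _ _ fst (fun x : prod_group => x i) _
      (@cvg_fst _ _ _ _ _) (proj_cont i _)).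
  exact: (@continuous_comp _ _ _ snd (fun x : prod_group => x i) _
    (@cvg_snd _ _ _ _ _) (proj_cont i _)).
exact: (@continuous_comp_initial _ _ _ _ _ h u).
Qed.

HB.instance Definition _ := PreTopologicalNmodule_isTopologicalZmodule.Build
  prod_group prod_group_sub_continuous.

End ProductZmodule.

Section SubgroupTopology.
Variables (G : topologicalZmodType) (H : zmodClosed G).

Definition subgroup : Type := {x : G | x \in H}.

HB.instance Definition _ := SubChoice.on subgroup.
HB.instance Definition _ := [SubChoice_isSubZmodule of subgroup by <:].
HB.instance Definition _ :=
  Topological.copy subgroup (initial_topology (val : subgroup -> G)).

Lemma subgroup_sub_continuous :
  continuous (fun x : subgroup * subgroup => x.1 - x.2).
Proof.
have val_cont : continuous (val : subgroup -> G) by exact: initial_continuous.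
apply: continuous_comp_initial => w.
rewrite (_ : _ \o _ = fun w : subgroup * subgroup => val w.1 - val w.2); last first.
  by apply/funext => v.
apply: (@continuous_comp _ _ _
  (fun w : subgroup * subgroup => (val w.1, val w.2))
  (fun x : G * G => x.1 - x.2)); last exact: sub_continuous.
apply: cvg_pair.
  exact: (@continuous_comp _ _ _ fst (val : subgroup -> G) _
    (@cvg_fst _ _ _ _ _) (val_cont _)).
exact: (@continuous_comp _ _ _ snd (val : subgroup -> G) _
  (@cvg_snd _ _ _ _ _) (val_cont _)).
Qed.

HB.instance Definition _ := PreTopologicalNmodule_isTopologicalZmodule.Build
  subgroup subgroup_sub_continuous.

End SubgroupTopology.

Section ProfiniteCompletion.
Variable A : zmodType.

Record fi_subgroup := FiSubgroup {
  fi_val :> zmodClosed A;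
  fi_valP : finite_index fi_val
}.

HB.instance Definition _ := gen_eqMixin fi_subgroup.
HB.instance Definition _ := gen_choiceMixin fi_subgroup.

Definition finite_quotients : topologicalZmodType :=
  prod_group (fun N : fi_subgroup => discrete_topology {quot N}).

(* The transition map A/N -> A/M, for N contained in M, sends the coset of [a]
   modulo N to the coset of [a] modulo M. *)
Definition compatible : {pred finite_quotients} := fun x =>
  `[< forall N M : fi_subgroup, {subset N <= M} ->
      forall a : A, x N = \pi_{quot N} a -> x M = \pi_{quot M} a >].

Lemma compatible_zmod_closed : zmod_closed compatible.
Proof.
split=> [|x y /asboolP cx /asboolP cy]; apply/asboolP => N M NM a.
  rewrite -[LHS](raddf0 \pi_{quot N}) => /(introT eqP).
  rewrite -Quotient.idealrBE => /NM; rewrite Quotient.idealrBE => /eqP <-.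
  by rewrite raddf0.
rewrite -[(x - y) N]/(x N - y N) -[(x - y) M]/(x M - y M).
have [[b bE] [c cE]] : (exists b, x N = \pi b) /\ (exists c, y N = \pi c).
  by split; [exists (repr (x N)) | exists (repr (y N))]; rewrite reprK.
rewrite (cx _ _ NM _ bE) (cy _ _ NM _ cE) bE cE -!raddfB => /(introT eqP).
by rewrite -Quotient.idealrBE => /NM; rewrite Quotient.idealrBE => /eqP.
Qed.

HB.instance Definition _ := GRing.isZmodClosed.Build finite_quotients compatible
  compatible_zmod_closed.

Definition profinite_completion : topologicalZmodType := subgroup compatible.

End ProfiniteCompletion.

Section TopologicalGroups.
Variable G : topologicalZmodType.

Definition topologically_hopfian : Prop :=
  forall f : {additive G -> G}, continuous f ->
    (forall y, exists x, f x = y) -> injective f.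

Definition finitely_generated (H : zmodClosed G) : Prop :=
  exists s : seq G, {subset s <= H} /\
    forall K : zmodClosed G, {subset s <= K} -> {subset H <= K}.

Definition topologically_finitely_generated : Prop :=
  exists H : zmodClosed G, finitely_generated H /\ dense [set` H].

Definition profinite : Prop :=
  [/\ compact [set: G], hausdorff_space G & totally_disconnected [set: G]].

Definition pro_p (p : nat) : Prop :=
  profinite /\
  forall U : zmodClosed G, open [set` U] -> exists k, has_index U (p ^ k).

End TopologicalGroups.

(* The index of a closed subgroup H of a profinite group is the supernatural
   number lcm [G : U] over the open subgroups U containing H; the last clause
   says that it is prime to p. *)
Definition sylow_pro_p (G : topologicalZmodType) (p : nat) (P : zmodClosed G) : Prop :=
  [/\ closed [set` P], pro_p (subgroup P) p &
      forall U : zmodClosed G, open [set` U] -> {subset P <= U} ->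
        exists2 n, has_index U n & coprime p n].

(* Main.v *)
Require Import Defs.
From mathcomp Require Import fingroup cyclic pgroup.
From HB Require Import structures.
From mathcomp Require Import all_boot all_order all_algebra.
From mathcomp Require Import all_classical topology tvs.

(* Write G for the profinite completion and, for a prime p, let E be the
   projection of G onto its p-primary component: on A/N it is multiplication by
   an idempotent integer. The image of E is the unique Sylow pro-p subgroup. If
   finitely many elements generate A modulo pA, their images under E topologically
   generate it. Conversely d topological generators of the image of E bound the
   index of every finite-index N containing pA by p^d, and finite-index subgroups
   containing pA separate the points of A/pA, so A/pA is finite.

   If all A/pA are finite, so are all A/nA; a continuous surjective endomorphism
   of G preserves the closure of nG, hence induces a surjective, thus bijective,
   endomorphism of A/nA, and its kernel is trivial.

   If A/pA is infinite, a p-basic subgroup B of A (a maximal p-independent family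
   of cyclic subgroups) has infinitely many generators, among which one finds a
   sequence x_0, x_1, ... of nondecreasing orders. Sending x_(i+1) to x_i, x_0 to
   0 and fixing the other generators is well defined on B/p^rB = A/p^rA for all r.
   Acting like this on the p-primary component of G and as the identity on the
   others gives a continuous endomorphism; it has dense, hence full, image and
   kills the nonzero p-primary component of x_0. *)

Set Implicit Arguments.
Unset Strict Implicit.
Unset Printing Implicit Defensive.

Import GRing.Theory.

Local Open Scope classical_set_scope.
Local Open Scope ring_scope.
Local Open Scope quotient_scope.

(** * Subgroups of finite index *)

Definition subgroup_of (A : zmodType) (P : A -> Prop) (P0 : P 0)
    (PB : forall x y, P x -> P y -> P (x - y)) : zmodClosed A :=
  HB.pack (fun a : A => `[< P a >])
    (GRing.isZmodClosed.Build A (fun a => `[< P a >])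
      (conj (asboolT P0)
        (fun x y Px Py => asboolT (PB x y (asboolW Px) (asboolW Py))))).

Lemma mem_subgroup_of (A : zmodType) P P0 PB (a : A) :
  a \in @subgroup_of A P P0 PB <-> P a.
Proof. by split=> [/asboolP|Pa]; last exact/asboolP. Qed.

Lemma pi_eqP (A : zmodType) (N : zmodClosed A) (a b : A) :
  \pi_{quot N} a = \pi_{quot N} b <-> a - b \in N.
Proof. by rewrite Quotient.idealrBE; split=> /eqP. Qed.

Lemma multiplesP (A : zmodType) n (a : A) :
  a \in multiples A n <-> exists b, a = b *+ n.
Proof. by split=> [/asboolP|h]; last exact/asboolP. Qed.

Lemma multiples_mulrn (A : zmodType) n (a : A) : a *+ n \in multiples A n.
Proof. by apply/multiplesP; exists a. Qed.

(** [F] labels the elements of [A] by the finite set [D], and a shared label forces congruence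
    modulo [N]; choosing a label for each coset injects the quotient into [D]. *)
Lemma finite_index_inj (A : zmodType) (N : zmodClosed A) (T : choiceType)
    (D : set T) (F : A -> T -> Prop) :
  finite_set D -> (forall a, exists2 t, D t & F a t) ->
  (forall a b t, F a t -> F b t -> a - b \in N) -> finite_index N.
Proof.
move=> Dfin Fex Finj.
have [g gP] : {g & forall x : {quot N}, D (g x) /\ F (repr x) (g x)}.
  apply: (@choice _ _ (fun (x : {quot N}) t => D t /\ F (repr x) t)) => x.
  by have [t Dt Ft] := Fex (repr x); exists t.
apply: (@sub_finite_set _ _ (g @^-1` D)) => [x _|]; first exact: (gP x).1.
apply: finite_preimage Dfin => x y _ _ gxy.
rewrite -[x]reprK -[y]reprK; apply/pi_eqP.
by apply: (Finj _ _ (g x)); [exact: (gP x).2 | rewrite gxy; exact: (gP y).2].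
Qed.

Lemma finite_indexP (A : zmodType) (N : zmodClosed A) :
  finite_index N <-> exists s : seq A, forall a, exists2 b, b \in s & a - b \in N.
Proof.
split=> [/finite_seqP[s sE]|[s sP]].
  exists [seq repr x | x : {quot N} <- s] => a.
  exists (repr (\pi_{quot N} a)); last by apply/pi_eqP; rewrite reprK.
  apply: map_f; have : [set: {quot N}] (\pi a) by [].
  by rewrite sE.
apply: (@finite_index_inj _ _ A [set` s] (fun a b => a - b \in N)).
  exact: finite_seq.
  exact: sP.
move=> a b t aN bN; rewrite -[a](subrK t) -addrA -[t - b]opprB.
exact: rpredB.
Qed.


(** * Index and torsion in finite quotients *)

Section CauchyIndex.
Variables (A : zmodType) (U : zmodClosed A).

(** The quotient is repackaged as a finite group: Lagrange's theorem gives the exponent, and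
    Cauchy's theorem a class of order [q] for each prime [q] dividing the index. *)
Lemma index_cauchy : finite_index U -> exists n,
  [/\ has_index U n, (0 < n)%N, forall x, x *+ n \in U &
   forall q, prime q -> (q %| n)%N -> exists2 x, x \notin U & x *+ q \in U].
Proof.
move=> Ufin.
have [s sE] := (finite_seqP _).1 Ufin.
have sP : Finite.axiom (undup s : seq {quot U}).
  move=> x; rewrite count_uniq_mem ?undup_uniq // mem_undup.
  by have : [set: {quot U}] x by []; rewrite sE /= => ->.
have sK : cancel (fun x : {quot U} => index x s) (fun i => nth 0 s i).
  by move=> x; rewrite nth_index //; have : [set: {quot U}] x by []; rewrite sE.
pose fT : finZmodType := HB.pack {quot U} (CanIsCountable sK)
  (isFinite.Build {quot U} sP).
pose gT : finGroupType := fT.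
have piE x k : \pi_{quot U} (x *+ k) = ((\pi_{quot U} x : gT) ^+ k)%g.
  exact: raddfMn.
have pi1 x : (\pi_{quot U} x = 1%g :> gT) <-> x \in U.
  by rewrite -[x in x \in U]subr0 -pi_eqP raddf0.
exists #|gT|; split.
- rewrite /has_index (_ : [set: {quot U}] = (@enum_val fT predT) @` [set: _]).
    apply: card_eq_trans (card_esym card_II).
    apply: inj_card_eq => i j _ _ ij; exact: (@enum_val_inj fT predT).
  by apply/seteqP; split=> // x _; exists (enum_rank (x : fT)); rewrite //= enum_rankK.
- by apply/card_gt0P; exists 1%g.
- move=> x; apply/pi1; rewrite piE -cardsT.
  by apply: (@expg_cardG gT [group of [set: gT]]); rewrite inE.
- move=> q qp; rewrite -cardsT => qd.
  have [x _ xq] := @Cauchy gT q [group of [set: gT]] qp qd.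
  exists (repr (x : {quot U})); last first.
    by apply/pi1; rewrite piE reprK -xq expg_order.
  apply/negP => /pi1; rewrite reprK => x1.
  by move: qp; rewrite -xq x1 order1.
Qed.


Lemma has_index_mulrn n x : has_index U n -> x *+ n \in U.
Proof.
move=> Un; have [m [Um _ /(_ x) + _]] := index_cauchy (ex_intro _ n Un).
suff -> : n = m by [].
by apply/card_eq_II; apply: card_eq_trans (card_esym Un) Um.
Qed.

Lemma coprime_mulrn_mem m n x :
  coprime m n -> x *+ m \in U -> x *+ n \in U -> x \in U.
Proof.
case: (posnP m) => [->|m0]; first by rewrite /coprime gcd0n => /eqP ->.
move=> /eqP mn xm xn; case: (egcdnP n m0) => u v; rewrite mn => e _.
rewrite -[x](addKr (x *+ (v * n))) addrC -mulrSr -addn1 -e rpredB //.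
  by rewrite mulnC mulrnA rpredMn.
by rewrite mulnC mulrnA rpredMn.
Qed.

(** By Cauchy, a prime [q] dividing the index yields a nonzero class killed by [q]; a power of [p]
    kills it as well, so [q = p]. *)
Lemma index_pgroup p : prime p -> finite_index U ->
  (forall x, exists k, x *+ p ^ k \in U) -> exists k, has_index U (p ^ k).
Proof.
move=> pp /index_cauchy[n [Un n0 _ cn]] pU.
suff /p_natP[k nk] : p.-nat n by exists k; rewrite -nk.
apply/pnatP => // q qp /(cn _ qp)[x /negP xU xq]; apply/eqP; apply: contrapT => qNp.
have [k xk] := pU x; apply: xU; apply: coprime_mulrn_mem xq xk.
by rewrite coprimeXr // prime_coprime // dvdn_prime2 //; apply/eqP.
Qed.

Lemma index_coprime p : prime p -> finite_index U ->
  (forall x, exists2 m, coprime p m & x *+ m \in U) ->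
  exists2 n, has_index U n & coprime p n.
Proof.
move=> pp /index_cauchy[n [Un n0 _ cn]] pU; exists n => //.
rewrite prime_coprime //; apply/negP => /(cn _ pp)[x /negP xU xp].
by have [m pm xm] := pU x; apply: xU; exact: coprime_mulrn_mem pm xp xm.
Qed.

End CauchyIndex.

(** * Coordinates and topology of the completion *)

Lemma fi_subgroupI (A : zmodType) (N M : fi_subgroup A) :
  exists L : fi_subgroup A, forall a, a \in L <-> a \in N /\ a \in M.
Proof.
have I0 : 0 \in N /\ 0 \in M by rewrite !rpred0.
have IB x y : x \in N /\ x \in M -> y \in N /\ y \in M -> x - y \in N /\ x - y \in M.
  by move=> [xN xM] [yN yM]; rewrite !rpredB.
pose L := @subgroup_of A (fun a => a \in N /\ a \in M) I0 IB.
suff Lfin : finite_index L by exists (FiSubgroup Lfin) => a; exact: mem_subgroup_of.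
apply: (@finite_index_inj _ _ ({quot N} * {quot M})%type ([set: _] `*` [set: _])
  (fun a t => t = (\pi a, \pi a))).
- by apply: finite_setX; exact: fi_valP.
- by move=> a; exists (\pi a, \pi a).
- by move=> a b _ -> [] /pi_eqP abN /pi_eqP abM; apply/mem_subgroup_of; split.
Qed.

Lemma fi_subgroupT (A : zmodType) : exists N : fi_subgroup A, forall a, a \in N.
Proof.
pose T := @subgroup_of A (fun=> True) I (fun _ _ _ _ => I).
have TP a : a \in T by exact/mem_subgroup_of.
suff Tfin : finite_index T by exists (FiSubgroup Tfin).
by apply/finite_indexP; exists [:: 0] => a; exists 0; rewrite ?mem_head.
Qed.

Section Coordinates.
Variable A : zmodType.
Local Notation hat := (profinite_completion A).
Implicit Types (x y : hat) (N M : fi_subgroup A) (a b : A).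

(** Coordinates are handled through representatives in [A], so that later arguments become
    membership statements about [N]. *)
Definition at_coset x N a : Prop := val x N = \pi_{quot N} a.

Lemma at_ex x N : exists a, at_coset x N a.
Proof. by exists (repr (val x N)); rewrite /at_coset reprK. Qed.

Lemma at_eq x N a b : at_coset x N a -> at_coset x N b <-> a - b \in N.
Proof. by rewrite /at_coset => ->; exact: pi_eqP. Qed.

Lemma at_sub x y N a b :
  at_coset x N a -> at_coset y N b -> at_coset (x - y) N (a - b).
Proof.
move=> xa yb; rewrite /at_coset.
by rewrite -[LHS]/(val x N - val y N) xa yb raddfB.
Qed.

Lemma at0 N : at_coset 0 N 0.
Proof. by rewrite /at_coset !raddf0. Qed.

Lemma at_mulrn x N a n : at_coset x N a -> at_coset (x *+ n) N (a *+ n).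
Proof.
move=> xa; elim: n => [|n IHn]; first exact: at0.
by have := at_sub IHn (at_sub (at0 N) xa); rewrite !sub0r !opprK -!mulrSr.
Qed.

Lemma at_le x N M a : {subset N <= M} -> at_coset x N a -> at_coset x M a.
Proof. by have /asboolP h := valP x; move=> NM; exact: h. Qed.

Lemma at_ext x y : (forall N, exists a, at_coset x N a /\ at_coset y N a) -> x = y.
Proof.
move=> xy; apply/val_inj; apply: functional_extensionality_dep => N.
by have [a [xa ya]] := xy N; rewrite xa ya.
Qed.

Lemma at_mk (c : fi_subgroup A -> A) :
  (forall N M, {subset N <= M} -> c N - c M \in M) ->
  exists x, forall N, at_coset x N (c N).
Proof.
move=> cNM; pose x : finite_quotients A := fun N => \pi_{quot N} (c N).
suff xc : x \in @compatible A by exists (Sub x xc).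
apply/asboolP => N M NM a /pi_eqP/NM aM; apply/pi_eqP.
by rewrite -[c M](subrK (c N)) -addrA rpredD // -opprB rpredN cNM.
Qed.

Lemma at_const a : exists x, forall N, at_coset x N a.
Proof. by apply: (@at_mk (fun=> a)) => N M _; rewrite subrr rpred0. Qed.

Lemma at_subP x y N a :
  at_coset x N a -> at_coset (y - x) N 0 <-> at_coset y N a.
Proof.
move=> xa; have [b yb] := at_ex y N; have yxba := at_sub yb xa.
by rewrite (at_eq _ yxba) subr0 (at_eq _ yb).
Qed.

(** Agreement with [x] at one coordinate [N] generates a filter, because coordinates can be
    intersected. It converges to [x] coordinatewise, hence in the product, so it contains every
    neighbourhood. *)
Lemma compl_nbhs x (U : set hat) :
  nbhs x U -> exists N, forall y, at_coset (y - x) N 0 -> U y.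
Proof.
move=> xU.
have [T0 T0P] := fi_subgroupT A.
pose F := filter_from [set: fi_subgroup A]
  (fun N => [set y : hat | at_coset (y - x) N 0]).
have FF : Filter F.
  apply: filter_from_filter; first by exists T0.
  move=> N M _ _; have [L LP] := fi_subgroupI N M; exists L => // y /= yL.
  by split=> /=; [apply: at_le yL => a /LP[] | apply: at_le yL => a /LP[]].
suff : F --> x by move=> /(_ _ xU)[N _ NU]; exists N.
move=> V [_ [[W Wop <-] Wx WV]].
have : (val : hat -> _) @ F --> (val x : prod_topology _).
  apply/cvg_sup => N O [_ [[B Bop <-] xB BO]].
  exists N => // y /= yx; apply: BO => /=; have [a xa] := at_ex x N.
  by have := (at_subP y xa).1 yx; rewrite /at_coset => ->; rewrite -xa.
have Wn : nbhs (val x) W by apply: open_nbhs_nbhs; split.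
by move=> /(_ _ Wn) FW; exact: filterS WV FW.
Qed.

End Coordinates.

(** * Topology of subgroups *)

Section SubgroupSpace.
Variables (G : topologicalZmodType) (H : zmodClosed G).

Lemma subgroup_val_continuous : continuous (val : subgroup H -> G).
Proof. exact: initial_continuous. Qed.

(** A filter on [H] is pushed forward to [G], where the closed set [H] is compact; the cluster point
    lies in [H], and remains one there because [H] has the initial topology. *)
Lemma subgroup_compact :
  compact [set: G] -> closed [set` H] -> compact [set: subgroup H].
Proof.
move=> Gc Hc F FP FT.
have Hcomp := subclosed_compact Hc Gc (@subsetT _ _).
have FH : F ((val : subgroup H -> G) @^-1` [set` H]).
  by apply: (@filterS _ F _ setT) => // y _; exact: (valP y).
have [p [pH pcl]] := Hcomp _ (fmap_proper_filter (val : subgroup H -> G) FP) FH.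
exists (Sub p pH); split=> // C B FC [_ [[W Wop <-] Wp WB]].
have CI : F ((val : subgroup H -> G) @^-1` (val @` C)).
  by apply: (@filterS _ F _ C) => // y Cy; exists y.
have [|_ [[q Cq <-] Wq]] := pcl _ W CI; first by apply: open_nbhs_nbhs; split.
by exists q; split=> //; exact: WB. Qed.

Lemma subgroup_zero_dimensional :
  zero_dimensional G -> zero_dimensional (subgroup H).
Proof.
move=> Gz x y xy; have [|U [Ucl Ux Uy]] := Gz (val x) (val y).
  by apply: contra_neq xy => /val_inj.
exists (val @^-1` U); split=> //; apply: preimage_clopen => // z.
exact: subgroup_val_continuous.
Qed.

End SubgroupSpace.

Lemma zero_dimensional_hausdorff (T : topologicalType) :
  zero_dimensional T -> hausdorff_space T.
Proof.
move=> Tz x y xy; apply/eqP; apply: contrapT => /negP /Tz[U [[Uo Uc] Ux Uy]].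
have [||z []//] := xy U (~` U); apply: open_nbhs_nbhs; split=> //.
exact: closed_openC.
Qed.

(** * The completion as a profinite group, and its endomorphisms *)

Section Profinite.
Variable A : zmodType.
Local Notation hat := (profinite_completion A).

Lemma finite_quotients_zero_dimensional :
  zero_dimensional (finite_quotients A).
Proof.
apply: (@zero_dimension_prod (fi_subgroup A)
  (fun N => discrete_topology {quot N})) => N.
exact: discrete_zero_dimension.
Qed.

Lemma finite_quotients_compact : compact [set: finite_quotients A].
Proof.
have := @tychonoff (fi_subgroup A) (fun N => discrete_topology {quot N})
  (fun=> setT).
rewrite (_ : [set f | _] = setT); last by apply/seteqP; split.
apply => N; apply: finite_compact; exact: fi_valP.
Qed.

Lemma completion_zero_dimensional : zero_dimensional hat.
Proof. exact/subgroup_zero_dimensional/finite_quotients_zero_dimensional. Qed.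

(** The product of the finite quotients is compact by Tychonoff. The limit is closed in it, since
    each instance of compatibility involves two coordinates only, and these are locally constant. *)
Lemma completion_compact : compact [set: hat].
Proof.
apply: subgroup_compact; first exact: finite_quotients_compact.
move=> x clx; apply/asboolP => N M NM a xN.
have xnbhs i : nbhs x [set y : finite_quotients A | y i = x i].
  exact: (@proj_continuous (fi_subgroup A) (fun N => discrete_topology {quot N})
    i x _ (discrete_set1 (x i : discrete_topology {quot i}))).
have [y [/asboolP yc [yN yM]]] := clx _ (filterI (xnbhs N) (xnbhs M)).
by rewrite -yM; apply: (yc _ _ NM); rewrite yN.
Qed.

Implicit Types (x y : hat) (N M : fi_subgroup A) (a b : A).

Lemma nbhs_coset x N : nbhs x [set y | at_coset (y - x) N 0].
Proof.
have [a xa] := at_ex x N.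
have /filterS : forall y : hat, val y N = val x N -> at_coset (y - x) N 0.
  by move=> y yx; apply/(at_subP y xa); rewrite /at_coset yx.
apply; apply: (@subgroup_val_continuous _ (@compatible A) x
  [set z : finite_quotients A | z N = val x N]).
exact: (@proj_continuous (fi_subgroup A) (fun N => discrete_topology {quot N})
  N (val x) _ (discrete_set1 (val x N : discrete_topology {quot N}))).
Qed.

Lemma completion_closed (S : set hat) :
  (forall x, (forall N, exists2 y, S y & at_coset (y - x) N 0) -> S x) -> closed S.
Proof.
move=> SP x clx; apply: SP => N; have [y [Sy yx]] := clx _ (nbhs_coset x N).
by exists y.
Qed.

Lemma closed_completion (S : set hat) x : closed S ->
  (forall N, exists2 y, S y & at_coset (y - x) N 0) -> S x.
Proof.
move=> Scl xP; apply: Scl => U /compl_nbhs[N NU].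
by have [y Sy yx] := xP N; exists y; split=> //; exact: NU.
Qed.

Lemma open_coset N : open [set x | at_coset (x : hat) N 0].
Proof.
rewrite openE => x /= xN; rewrite /interior.
apply: filterS (nbhs_coset x N) => y /= yx.
exact: (at_subP _ xN).1 yx.
Qed.

Lemma open_completion (U : set hat) x : open U -> U x ->
  exists N, forall y, at_coset (y - x) N 0 -> U y.
Proof. by move=> Uo Ux; apply: compl_nbhs; exact: open_nbhs_nbhs. Qed.

Lemma completion_profinite (P : zmodClosed hat) :
  closed [set` P] -> profinite (subgroup P).
Proof.
move=> Pcl; have Pz := subgroup_zero_dimensional (H := P) completion_zero_dimensional.
split.
- by apply: subgroup_compact => //; exact: completion_compact.
- exact: zero_dimensional_hausdorff.
- exact: zero_dimension_totally_disconnected.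
Qed.

Lemma open_subgroup (P : zmodClosed hat) (U : set (subgroup P)) (x : subgroup P) :
  open U -> U x ->
  exists N, forall y : subgroup P, at_coset ((val y : hat) - (val x : hat)) N 0 -> U y.
Proof.
move=> [W Wo <-] Wx; have [N NW] := open_completion Wo Wx.
by exists N => y; exact: NW.
Qed.

(** Each [F N] is additive only modulo [N]. The preimage [K N] of [N] under it has finite index, and
    the coordinate of the image at [N] is read off from the coordinate of [x] at [K N]; continuity
    follows. *)
Lemma completion_extend (F : fi_subgroup A -> A -> A) :
  (forall N a b, F N (a - b) - (F N a - F N b) \in N) ->
  (forall N M, {subset N <= M} -> forall a, F N a - F M a \in M) ->
  exists f : {additive hat -> hat}, continuous f /\
    forall x N, exists K, forall a, at_coset x K a -> at_coset (f x) N (F N a).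
Proof.
move=> Fadd Fcoh.
have F0 N : F N 0 \in N by have := Fadd N 0 0; rewrite !subrr subr0.
have FB N a b : F N a \in N -> F N b \in N -> F N (a - b) \in N.
  move=> aN bN; rewrite -[F N (a - b)](subrK (F N a - F N b)).
  by apply: rpredD; [exact: Fadd | exact: rpredB].
have Fcong N a b : F N (a - b) \in N -> F N a - F N b \in N.
  move=> abN; rewrite -[_ - F N b](subKr (F N (a - b))).
  by apply: rpredB => //; exact: Fadd.
have [K KP] : {K & forall N a, (a \in (K N : fi_subgroup A)) <-> F N a \in N}.
  apply: (@choice _ _ (fun N (K : fi_subgroup A) => forall a, a \in K <-> F N a \in N)).
  move=> N; pose L := @subgroup_of A (fun a => F N a \in N) (F0 N) (FB N).
  suff Lfin : finite_index L by exists (FiSubgroup Lfin) => a; exact: mem_subgroup_of.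
  apply: (@finite_index_inj A L {quot N} setT (fun a t => t = \pi_{quot N} (F N a))).
  - exact: fi_valP.
  - by move=> a; exists (\pi_{quot N} (F N a)).
  - move=> a b _ -> /pi_eqP abN; apply/mem_subgroup_of.
    rewrite -[F N (a - b)](subrK (F N a - F N b)).
    by apply: rpredD => //; exact: Fadd.
have Feq x N a b : at_coset x (K N) a -> at_coset x (K N) b -> F N a - F N b \in N.
  by move=> xa /(at_eq _ xa)/KP; exact: Fcong.
have [f fP] : {f : hat -> hat & forall x N a,
    at_coset x (K N) a -> at_coset (f x) N (F N a)}.
  apply: (@choice _ _ (fun x (y : hat) => forall N a,
    at_coset x (K N) a -> at_coset y N (F N a))) => x.
  have rK N : at_coset x (K N) (repr (val x (K N))) by rewrite /at_coset reprK.
  have [|y yP] := @at_mk A (fun N => F N (repr (val x (K N)))); last first.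
    exists y => N a xa; apply/(at_eq _ (yP N)); exact: Feq (rK N) xa.
  (* The chosen representatives at [K N] and [K M] are unrelated; both are compared with one
     representative [c] modulo the intersection. *)
  move=> N M NM; have [L LP] := fi_subgroupI (K N) (K M).
  have [c xc] := at_ex x L.
  have xN : at_coset x (K N) c by apply: at_le xc => d /LP[].
  have xM : at_coset x (K M) c by apply: at_le xc => d /LP[].
  rewrite -(subrKA (F N c)) -[X in _ + X](subrKA (F M c)).
  apply: rpredD; first exact/NM/(Feq _ _ _ _ (rK N)).
  by apply: rpredD; [exact: Fcoh|exact: Feq xM (rK M)].
have fB : zmod_morphism f.
  move=> x y; apply: at_ext => N.
  have [[a xa] [b yb]] := (at_ex x (K N), at_ex y (K N)).
  have fab := at_sub (fP _ _ _ xa) (fP _ _ _ yb).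
  exists (F N a - F N b); split=> //.
  apply/(at_eq _ (fP _ _ _ (at_sub xa yb))); exact: Fadd.
pose g : {additive hat -> hat} := HB.pack f (GRing.isZmodMorphism.Build _ _ f fB).
exists g; split; last by move=> x N; exists (K N) => a; exact: fP.
move=> x V /compl_nbhs[N NV]; apply: filterS (nbhs_coset x (K N)) => y yx.
apply: NV; rewrite -fB; apply/(at_eq _ (fP _ _ _ yx)).
by rewrite subr0.
Qed.

End Profinite.

(** * Finite-index subgroups containing pA *)

Section Residual.
Variables (A : zmodType) (p : nat).
Hypothesis pp : prime p.

Lemma mulrz_mod (N : zmodClosed A) a (u : int) : {subset multiples A p <= N} ->
  exists i : 'I_p, a *~ u - a *+ i \in N.
Proof.
move=> pN; have p0 := prime_gt0 pp; have pz : (p%:Z != 0) by rewrite eqz_nat -lt0n.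
have lt : (`|(u %% p)%Z| < p)%N.
  by rewrite -ltz_nat gez0_abs ?modz_ge0 // ltz_pmod.
exists (Ordinal lt); rewrite /= {1}(divz_eq u p) [a *+ _]pmulrn gez0_abs ?modz_ge0 //.
rewrite mulrzDr addrK mulrzA -pmulrn.
by apply: pN; exact: multiples_mulrn.
Qed.

(** Reducing the coefficients modulo [p] leaves finitely many combinations, whose number depends
    only on the size of [t]. *)
Lemma mod_comb_bounded (N : zmodClosed A) (t : seq A) a (c : nat -> int) :
    {subset multiples A p <= N} -> a - \sum_(i < size t) t`_i *~ c i \in N ->
  exists d : {ffun 'I_(size t) -> 'I_p}, a - \sum_(i < size t) t`_i *+ d i \in N.
Proof.
move=> pN ac.
have [d dP] : {d : 'I_(size t) -> 'I_p &
    forall i : 'I_(size t), t`_i *~ c i - t`_i *+ d i \in N}.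
  apply: (@choice _ _ (fun (i : 'I_(size t)) (j : 'I_p) => t`_i *~ c i - t`_i *+ j \in N)).
  by move=> i; exact: mulrz_mod.
exists [ffun i => d i].
rewrite -(subrKA (\sum_(i < size t) t`_i *~ c i)) rpredD // -sumrB rpred_sum // => i _.
by rewrite ffunE.
Qed.

(** Zorn's lemma gives a subgroup maximal among those containing pA and avoiding [a]. Any [b]
    outside it generates [a] modulo it with a coefficient prime to [p], so conversely [b] is
    congruent to a multiple of [a]: there are at most [p] cosets. *)
Lemma exists_fi_subgroup_notin (a : A) : a \notin multiples A p ->
  exists N : fi_subgroup A, {subset multiples A p <= N} /\ a \notin N.
Proof.
move=> ap.
(* [Q] asks for stability under adding multiples of [p] instead of containment of pA, so that the
   union of the empty chain satisfies it; nonemptiness of the maximal set is recovered from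
   maximality. *)
pose Q (S : set A) := [/\ ~ S a, forall x y, S x -> S y -> S (x - y) &
  forall x c, S x -> S (x + c *+ p)].
have [S [[Sa SB Sp] Smax]] : exists S, Q S /\ forall T, S `<` T -> ~ Q T.
  apply: Zorn_bigcup => F FQ Ftot; split.
  - by move=> [X FX Xa]; have [] := FQ X FX.
  - move=> x y [X FX Xx] [Y FY Yy].
    have [XY|YX] := Ftot _ _ FX FY.
      by exists Y => //; have [_ YB _] := FQ Y FY; apply: YB => //; exact: XY.
    by exists X => //; have [_ XB _] := FQ X FX; apply: XB => //; exact: YX.
  - by move=> x c [X FX Xx]; exists X => //; have [_ _] := FQ X FX; exact.
have pQ : Q [set` multiples A p].
  split=> [|x y|x c xp]; first exact/negP.
    exact: rpredB.
  by rewrite /mkset rpredD // multiples_mulrn.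
have [s Ss] : exists s, S s.
  apply: contrapT => nS; apply: (Smax _ _ pQ); split.
    by move=> x Sx; case: nS; exists x.
  by move=> /(_ 0) /= h; case: nS; exists 0; apply: h; exact: rpred0.
have S0 : S 0 by rewrite -(subrr s); exact: SB.
have pS c : S (c *+ p) by rewrite -[_ *+ _]add0r; exact: Sp.
pose N := subgroup_of S0 SB.
have NP x : x \in N <-> S x by exact: mem_subgroup_of.
have pN : {subset multiples A p <= N} by move=> x /multiplesP[c ->]; apply/NP.
have aN : a \notin N by apply/negP => /NP.
suff Nfin : finite_index N by exists (FiSubgroup Nfin).
apply/finite_indexP; exists [seq a *+ i | i <- iota 0 p] => b.
have [bN|/negP bN] := boolP (b \in N).
  exists 0; last by rewrite subr0.
  by apply/mapP; exists 0%N; rewrite ?mem_iota ?prime_gt0.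
suff [u bu] : exists u, b - a *~ u \in N.
  have [i ui] := mulrz_mod a u pN; exists (a *+ i).
    by apply/mapP; exists (val i) => //; rewrite mem_iota /= add0n.
  by rewrite -(subrKA (a *~ u)) rpredD.
(* [T] is N + Zb. It properly contains [S], so it violates [Q], which it can do only by containing
   [a]. *)
pose T x := exists k : int, x - b *~ k \in N.
have [k ak] : T a.
  apply: contrapT => aT; apply: (Smax [set x | T x]).
    split=> [x Sx|ST]; first by exists 0; rewrite subr0; exact/NP.
    by apply: bN; apply/NP/ST; exists 1; rewrite subrr rpred0.
  split=> // [x y [k xk] [l yl]|x c [k xk]].
    exists (k - l); suff -> : x - y - b *~ (k - l) = (x - b *~ k) - (y - b *~ l).
      exact: rpredB.
    by rewrite mulrzBr !opprB addrACA [RHS]addrACA; congr (_ + _); exact: addrC.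
  by exists k; rewrite addrAC rpredD // pN // multiples_mulrn.
have kp : coprimez k p.
  rewrite coprimezE /= coprime_sym prime_coprime //; apply/negP => /dvdnP[m km].
  case/negP: aN; rewrite -(subrK (b *~ k) a) rpredD //.
  have -> : k = (sgz k * m)%Z * p by rewrite {1}[k]intEsg km PoszM mulrA.
  by rewrite mulrzA -pmulrn pN // multiples_mulrn.
have [u [v uv]] := Bezoutz k p; exists u.
have {uv} uv : u * k + v * p = 1 by rewrite uv; apply/eqP.
have -> : b - a *~ u = b *~ v *+ p - (a - b *~ k) *~ u.
  rewrite mulrzBl opprB addrA; congr (_ - _).
  by rewrite pmulrn -!mulrzA -mulrzDr addrC [k * u]mulrC uv.
by rewrite rpredB ?rpredMz // pN // multiples_mulrn.
Qed.

Lemma exists_fi_subgroup_all_notin (s : seq A) :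
    (forall a, a \in s -> a \notin multiples A p) ->
  exists N : fi_subgroup A, {subset multiples A p <= N} /\
    forall a, a \in s -> a \notin N.
Proof.
elim: s => [|a s IHs] sP.
  by have [N NT] := fi_subgroupT A; exists N; split=> // x _; exact: NT.
have [|N [pN sN]] := IHs; first by move=> b bs; apply: sP; rewrite inE bs orbT.
have [M [pM aM]] := exists_fi_subgroup_notin (sP a (mem_head _ _)).
have [L LP] := fi_subgroupI N M; exists L; split.
  by move=> x xp; apply/LP; split; [exact: pN|exact: pM].
move=> b; rewrite inE => /orP[/eqP->|/sN/negP bN]; apply/negP => /LP[//].
by move=> _; exact/negP.
Qed.

End Residual.

(** * The projection onto the p-primary component *)

Lemma fi_exponent (A : zmodType) (N : zmodClosed A) : finite_index N ->
  exists2 n, (0 < n)%N & forall a, a *+ n \in N.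
Proof. by move=> /index_cauchy[n [_ n0 nN _]]; exists n. Qed.

Lemma mulrn_dvd_mem (A : zmodType) (N : zmodClosed A) d n (a : A) :
  a *+ d \in N -> (d %| n)%N -> a *+ n \in N.
Proof. by move=> aN /dvdnP[m ->]; rewrite mulnC mulrnA rpredMn. Qed.

Lemma mulrn_eqmod_mem (A : zmodType) (N : zmodClosed A) d m n (a : A) :
  a *+ d \in N -> (m = n %[mod d])%N -> a *+ m - a *+ n \in N.
Proof.
move=> aN; wlog mn : m n / (n <= m)%N => [wl|/eqP].
  have [nm|/ltnW mn] := leqP n m; first exact: wl.
  by move=> /esym/(wl _ _ mn); rewrite -rpredN opprB.
by rewrite eqn_mod_dvd // -mulrnBr //; exact: mulrn_dvd_mem.
Qed.

Section PrimaryProjection.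
Variables (A : zmodType) (p : nat).
Hypothesis pp : prime p.

(* An integer that is 1 modulo p^(k!) and 0 modulo the p'-part of k!: on a group
   killed by k! it acts as the projection onto the p-primary component. *)
Definition primary_idem k := chinese (p ^ k`!) (partn k`! (negn p)) 1 0.

Local Notation w := primary_idem.
Local Notation cof k := (partn k`! (negn p)).
Local Notation modulus k := (p ^ k`! * (cof k))%N.

Lemma coprime_modulus k : coprime (p ^ k`!) (cof k).
Proof.
by apply: (@pnat_coprime p); rewrite ?part_pnat // pnatX pnat_id.
Qed.

Lemma primary_idem1 k : (w k = 1 %[mod p ^ k`!])%N.
Proof. exact/chinese_modl/coprime_modulus. Qed.

Lemma dvdn_primary_idem k : ((cof k) %| w k)%N.
Proof. by apply/eqP; rewrite -(mod0n (cof k)); exact/chinese_modr/coprime_modulus. Qed.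

(** The p-adic valuation of k! is smaller than k!, so p^(k!) is a multiple of the p-part of k!. *)
Lemma dvdn_modulus k : (k`! %| modulus k)%N.
Proof.
rewrite -{1}(partnC p (fact_gt0 k)) dvdn_pmul2r ?part_gt0 // p_part dvdn_exp2l //.
by rewrite ltnW // ltn_logl ?fact_gt0.
Qed.

Lemma dvdn_primary_idem_exp k : (k`! %| w k * p ^ k`!)%N.
Proof.
by apply: dvdn_trans (dvdn_modulus k) _; rewrite mulnC dvdn_mul ?dvdn_primary_idem.
Qed.

(** By the Chinese remainder theorem the two numbers agree modulo [modulus k], a multiple of k!. *)
Lemma primary_idem_mod k x y : (x = y %[mod p ^ k`!])%N ->
  ((cof k) %| x)%N -> ((cof k) %| y)%N -> (x = y %[mod k`!])%N.
Proof.
move=> xy /eqP x0 /eqP y0; apply/eqP.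
have : (x == y %[mod modulus k])%N.
  rewrite chinese_remainder ?coprime_modulus // xy eqxx /=.
  by rewrite x0 y0.
by move=> /eqP h; rewrite -(modn_dvdm _ (dvdn_modulus k)) h modn_dvdm ?dvdn_modulus.
Qed.

Lemma primary_idem_le k l : (k <= l)%N -> (w l = w k %[mod k`!])%N.
Proof.
move=> kl; have kl' : (k`! %| l`!)%N.
  by rewrite (fact_split kl) dvdn_mulr.
apply: primary_idem_mod; last exact: dvdn_primary_idem.
  rewrite primary_idem1 -(modn_dvdm _ (dvdn_exp2l p (dvdn_leq (fact_gt0 l) kl'))).
  by rewrite primary_idem1 modn_dvdm // dvdn_exp2l // dvdn_leq ?fact_gt0.
by apply: dvdn_trans (dvdn_primary_idem l); rewrite partn_dvd ?fact_gt0.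
Qed.

Lemma primary_idemM k : (w k * w k = w k %[mod k`!])%N.
Proof.
apply: primary_idem_mod; rewrite ?dvdn_mulr ?dvdn_primary_idem //.
by rewrite -[LHS]modnMm !primary_idem1 modnMm.
Qed.

Lemma primary_idem_sub_mem k (a : A) : a *+ w k - a \in multiples A (p ^ k`!).
Proof.
have aP : a *+ p ^ k`! \in multiples A (p ^ k`!) by exact: multiples_mulrn.
by have := mulrn_eqmod_mem aP (primary_idem1 k); rewrite mulr1n.
Qed.

Lemma fi_factorial (N : fi_subgroup A) : exists k, forall a, a *+ k`! \in N.
Proof.
have [n n0 nN] := fi_exponent (fi_valP N); exists n => a.
by apply: mulrn_dvd_mem (nN a) _; rewrite dvdn_fact // n0 leqnn.
Qed.

(** Exponents are taken among factorials because these are totally ordered by divisibility, so any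
    two stages are comparable. *)
Definition fi_stage (N : fi_subgroup A) : nat := projT1 (cid (fi_factorial N)).

Lemma fi_stageP N a : a *+ (fi_stage N)`! \in N.
Proof. exact: (projT2 (cid (fi_factorial N)) a). Qed.

Lemma primary_idem_compat (N M : fi_subgroup A) a : {subset N <= M} ->
  a *+ w (fi_stage N) - a *+ w (fi_stage M) \in M.
Proof.
(* The stages are chosen independently of each other, so the inclusion of [N] in [M] does not order
   them. *)
move=> NM; have [kl|/ltnW lk] := leqP (fi_stage N) (fi_stage M).
  rewrite -opprB rpredN; apply: mulrn_eqmod_mem (primary_idem_le kl).
  exact/NM/fi_stageP.
apply: mulrn_eqmod_mem (primary_idem_le lk); exact/fi_stageP.
Qed.

Lemma primary_idem_exp_mem (N : fi_subgroup A) a :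
  a *+ w (fi_stage N) *+ p ^ (fi_stage N)`! \in N.
Proof.
by rewrite -mulrnA; apply: mulrn_dvd_mem (fi_stageP N a) (dvdn_primary_idem_exp _).
Qed.

Lemma primary_projection :
  exists f : {additive profinite_completion A -> profinite_completion A},
  continuous f /\
  forall x N a, at_coset x N a -> at_coset (f x) N (a *+ w (fi_stage N)).
Proof.
have [||f [fc fP]] := @completion_extend A (fun N a => a *+ w (fi_stage N)).
- by move=> N a b; rewrite mulrnBl subrr rpred0.
- by move=> N M NM a; exact: primary_idem_compat.
(* The extension describes [f x] through representatives modulo some [K] only; a representative
   common to [K] and [N] transfers the formula to any representative modulo [N]. *)
exists f; split=> // x N a xa; have [K KP] := fP x N.
have [L LP] := fi_subgroupI K N; have [c xc] := at_ex x L.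
have /KP fc' : at_coset x K c by apply: at_le xc => d /LP[].
have xN : at_coset x N c by apply: at_le xc => d /LP[].
by apply/(at_eq _ fc'); rewrite -mulrnBl rpredMn //; exact/(at_eq _ xN).
Qed.

End PrimaryProjection.

(** * Sylow subgroups *)

Section Sylow.
Variables (A : zmodType) (p : nat).
Hypothesis pp : prime p.
Local Notation hat := (profinite_completion A).
Local Notation w N := (primary_idem p (fi_stage N)).
Variable E : {additive hat -> hat}.
Hypothesis EP : forall x N a, at_coset x N a -> at_coset (E x) N (a *+ w N).
Implicit Types (x y : hat) (N : fi_subgroup A).

Lemma projection_torsion x N : at_coset (E x *+ p ^ (fi_stage N)`!) N 0.
Proof.
have [a xa] := at_ex x N; apply/(at_eq _ (at_mulrn _ (EP xa))).
by rewrite subr0 primary_idem_exp_mem.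
Qed.

Lemma projection_idem x : E (E x) = E x.
Proof.
apply: at_ext => N; have [a xa] := at_ex x N; exists (a *+ w N); split; last exact: EP.
apply/(at_eq _ (EP (EP xa))); rewrite -mulrnA.
by apply: mulrn_eqmod_mem (fi_stageP N a) _; exact: primary_idemM.
Qed.

(** The difference at [N] is killed by p^j and, by idempotence, by the idempotent integer itself,
    which is 1 modulo [p] and hence coprime to p^j. *)
Lemma projection_fix x N j : at_coset (x *+ p ^ j) N 0 -> at_coset (E x - x) N 0.
Proof.
have [a xa] := at_ex x N => /(at_eq _ (at_mulrn _ xa)); rewrite subr0 => aj.
apply/(at_eq _ (at_sub (EP xa) xa)); rewrite subr0.
apply: (@coprime_mulrn_mem _ _ (w N) (p ^ j)).
- rewrite coprimeXr // -coprime_modl.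
  have e := primary_idem1 pp (fi_stage N).
  have pd : (p %| p ^ (fi_stage N)`!)%N by rewrite dvdn_exp // fact_gt0.
  by rewrite -(modn_dvdm _ pd) e modn_dvdm // coprime_modl coprime1n.
- rewrite mulrnBl -mulrnA; apply: mulrn_eqmod_mem (fi_stageP N a) _.
  exact: primary_idemM.
- by rewrite mulrnBl rpredB // -mulrnA mulnC mulrnA rpredMn.
Qed.

(** As [P] is closed, [E x] need only be approximated at each [N]. The open subgroup [U], the sum of
    [P] and the kernel at [N], has index prime to [p], while a power of [p] takes [E x] into that
    kernel; so [E x] lies in [U]. *)
Lemma sylow_mem_projection (P : zmodClosed hat) x : sylow_pro_p p P -> E x \in P.
Proof.
move=> [Pcl _ Pidx]; apply: (closed_completion Pcl) => N.
pose Q y := exists2 u, u \in P & at_coset (u - y) N 0.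
have Q0 : Q 0 by exists 0; rewrite ?rpred0 // subrr; exact: at0.
have QB y z : Q y -> Q z -> Q (y - z).
  move=> [u uP uy] [v vP vz]; exists (u - v); first exact: rpredB.
  have := at_sub uy vz; rewrite subr0; congr (at_coset _ _ _).
  by rewrite !opprB addrACA [RHS]addrACA; congr (_ + _); exact: addrC.
pose U := subgroup_of Q0 QB.
have NU y : at_coset y N 0 -> y \in U.
  move=> yN; apply/mem_subgroup_of; exists 0; first exact: rpred0.
  by have := at_sub (at0 N) yN; rewrite subr0.
have Uo : open [set` U].
  rewrite openE => y yU; rewrite /interior.
  apply: filterS (nbhs_coset y N) => z /= /NU zy.
  suff : z - y + y \in U by rewrite subrK.
  exact: rpredD.
have PU : {subset P <= U}.
  by move=> u uP; apply/mem_subgroup_of; exists u; rewrite // subrr; exact: at0.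
have [n Un pn] := Pidx U Uo PU.
suff /mem_subgroup_of[u uP ux] : E x \in U by exists u.
apply: (@coprime_mulrn_mem _ _ (p ^ (fi_stage N)`!) n); first exact: coprimeXl.
  by apply: NU; exact: projection_torsion.
exact: has_index_mulrn.
Qed.

(** The kernel of the coordinate [N] on [P] is open, so its index in [P] is a power of [p], and that
    power kills the coordinate. *)
Lemma sylow_mem_torsion (P : zmodClosed hat) x N : sylow_pro_p p P -> x \in P ->
  exists j, at_coset (x *+ p ^ j) N 0.
Proof.
move=> [_ [_ Pp] _] xP.
pose Q (y : subgroup P) := at_coset (val y : hat) N 0.
have Q0 : Q 0 by exact: at0.
have QB (y z : subgroup P) : Q y -> Q z -> Q (y - z).
  by move=> yN zN; have := at_sub yN zN; rewrite subrr.
pose U := subgroup_of Q0 QB.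
have Uo : open [set` U].
  exists [set y | at_coset y N 0]; first exact: open_coset.
  by apply/seteqP; split=> y; [move=> h; apply/mem_subgroup_of | move=> /mem_subgroup_of].
have [k Uk] := Pp U Uo; exists k.
have /mem_subgroup_of := has_index_mulrn (Sub x xP : subgroup P) Uk.
by rewrite /Q raddfMn.
Qed.

Lemma completion_finite_index (H : zmodClosed hat) (U : zmodClosed (subgroup H)) N :
  (forall y : subgroup H, at_coset (val y : hat) N 0 -> y \in U) -> finite_index U.
Proof.
move=> NU; apply: (@finite_index_inj _ U {quot N} setT
  (fun (y : subgroup H) (t : {quot N}) => t = val (val y : hat) N)).
- exact: fi_valP.
- by move=> y; exists (val (val y : hat) N).
- move=> y z _ -> yz; apply: NU; have [a ya] := at_ex (val y : hat) N.
  have za : at_coset (val z : hat) N a by rewrite /at_coset -yz.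
  by have := at_sub ya za; rewrite subrr.
Qed.

(** An open subgroup contains the kernel of some coordinate [N]. Fixed points are killed at [N] by a
    power of [p], and the differences [x - E x] by a number prime to [p]; Cauchy's theorem turns
    this into the two index conditions. *)
Lemma projection_fixpoints_sylow : exists P : zmodClosed hat,
  sylow_pro_p p P /\ forall x, x \in P <-> E x = x.
Proof.
have Q0 : E 0 = 0 by rewrite raddf0.
have QB x y : E x = x -> E y = y -> E (x - y) = x - y by move=> ex ey; rewrite raddfB ex ey.
pose P := subgroup_of Q0 QB; exists P.
have PP x : x \in P <-> E x = x by exact: mem_subgroup_of.
have Pcl : closed [set` P].
  apply: completion_closed => x xP; apply/PP; apply: at_ext => N.
  have [y /PP yP yx] := xP N; have [a xa] := at_ex x N.
  have ya := (at_subP y xa).1 yx; exists a; split=> //.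
  have := EP ya; rewrite yP => yw; apply/(at_eq _ (EP xa)).
  exact: (at_eq _ yw).1.
split=> //; split=> //.
- split; first exact: completion_profinite.
  move=> U Uo; have [N NU] := open_subgroup Uo (rpred0 U).
  have {}NU (y : subgroup P) : at_coset (val y : hat) N 0 -> y \in U.
    by move=> yN; apply: NU; rewrite -[X in at_coset X _ _]/((val y : hat) - 0) subr0.
  apply: index_pgroup pp (completion_finite_index NU) _ => y.
  exists (fi_stage N)`!; apply: NU; rewrite raddfMn /=.
  have /PP <- := valP y; exact: projection_torsion.
- move=> U Uo PU; have [N NU] := open_completion Uo (rpred0 U).
  have {}NU y : at_coset y N 0 -> y \in U by move=> yN; apply: NU; rewrite subr0.
  apply: index_coprime => //.
    apply: (@finite_index_inj _ U {quot N} setT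
      (fun (y : hat) (t : {quot N}) => t = val y N)).
    + exact: fi_valP.
    + by move=> y; exists (val y N).
    + move=> y z _ -> yz; apply: NU; have [a ya] := at_ex y N.
      have za : at_coset z N a by rewrite /at_coset -yz.
      by have := at_sub ya za; rewrite subrr.
  move=> x; exists (partn (fi_stage N)`! (negn p)).
    by have := coprime_modulus pp (fi_stage N); rewrite coprime_pexpl ?fact_gt0.
  (* In the splitting of [x] into [x - E x] and [E x], the second summand lies in [P], and the first
     is killed at [N] by the p'-part of the factorial. *)
  rewrite -[x](subrK (E x)) mulrnDl rpredD //; last first.
    by rewrite rpredMn // PU //; apply/PP; exact: projection_idem.
  apply: NU; have [a xa] := at_ex x N.
  apply/(at_eq _ (at_mulrn _ (at_sub xa (EP xa)))).
  rewrite subr0 -opprB mulNrn rpredN.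
  have /multiplesP[c ->] := primary_idem_sub_mem pp (fi_stage N) a.
  rewrite -mulrnA; apply: mulrn_dvd_mem (fi_stageP N c) _.
  exact: dvdn_modulus.
Qed.

End Sylow.

(** * Topological generation *)

Definition combination (A : zmodType) (s : seq A) (c : nat -> int) : A :=
  \sum_(i < size s) s`_i *~ c i.

Section Generated.
Variables (A : zmodType) (s : seq A).

Let span a := exists c, a = combination s c.

Let span0 : span 0.
Proof. by exists (fun=> 0); rewrite /combination big1. Qed.

Let spanB x y : span x -> span y -> span (x - y).
Proof.
move=> [c ->] [d ->]; exists (fun i => c i - d i).
by rewrite /combination -sumrB; apply: eq_bigr => i _; rewrite mulrzBr.
Qed.

Definition generated := subgroup_of span0 spanB.

Lemma generatedP a : a \in generated <-> exists c, a = combination s c.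
Proof. exact: mem_subgroup_of. Qed.

Lemma mem_generated : {subset s <= generated}.
Proof.
move=> a sa; apply/generatedP; exists (fun i => (i == index a s)%:Z).
rewrite /combination.
have lt : (index a s < size s)%N by rewrite index_mem.
rewrite (bigD1 (Ordinal lt)) //= eqxx nth_index // big1 ?addr0 // => i.
by rewrite -val_eqE /= => /negbTE ->.
Qed.

Lemma generated_min (K : zmodClosed A) : {subset s <= K} -> {subset generated <= K}.
Proof.
move=> sK a /generatedP[c ->]; apply: rpred_sum => i _.
by apply: rpredMz; apply: sK; exact: mem_nth.
Qed.

End Generated.

Lemma generated_finitely (G : topologicalZmodType) (s : seq G) :
  finitely_generated (generated s).
Proof. by exists s; split; [exact: mem_generated | exact: generated_min]. Qed.

(** If a = b + p^r c, expanding [c] in turn as d + p e gives a = (b + p^r d) + p^(r+1) e. *)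
Lemma mod_multiples_exp (A : zmodType) (p : nat) (B : zmodClosed A) :
  (forall a, exists2 b, b \in B & a - b \in multiples A p) ->
  forall r a, exists2 b, b \in B & a - b \in multiples A (p ^ r).
Proof.
move=> Bp; elim=> [|r IHr] a.
  by exists 0; rewrite ?rpred0 // -[a - 0]mulr1n multiples_mulrn.
have [b bB /multiplesP[c ac]] := IHr a.
have [d dB /multiplesP[e ce]] := Bp c.
exists (b + d *+ p ^ r); first by rewrite rpredD // rpredMn.
by rewrite opprD addrA ac -mulrnBl ce -mulrnA -expnS multiples_mulrn.
Qed.

Section Bounded.
Variables (A : zmodType) (p : nat).
Hypothesis pp : prime p.

(** Otherwise there are [#|T|.+1] elements pairwise incongruent modulo pA. A single [N] containing
    pA avoids all their differences, which contradicts the pigeonhole principle for [T]. *)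
Lemma finite_index_bounded (T : finType) :
  (forall N : fi_subgroup A, {subset multiples A p <= N} ->
     exists g : A -> T, forall a b, g a = g b -> a - b \in N) ->
  finite_index (multiples A p).
Proof.
move=> bd; apply: contrapT => infp.
have [l [lu ls lP]] : exists l : seq A, [/\ uniq l, size l = #|T|.+1 &
    forall a b, a \in l -> b \in l -> a != b -> a - b \notin multiples A p].
  elim: #|T|.+1 => [|n [l [lu ls lP]]]; first by exists [::].
  have [a aP] : exists a, forall b, b \in l -> a - b \notin multiples A p.
    apply: contrapT => na; apply/infp/finite_indexP; exists l => a.
    apply: contrapT => aP; apply: na; exists a => b bl; apply/negP => ab.
    by apply: aP; exists b.
  exists (a :: l); split; rewrite /= ?ls // ?lu ?andbT.
    by apply/negP => /aP; rewrite subrr rpred0.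
  move=> x y; rewrite !inE => /orP[/eqP->|xl] /orP[/eqP->|yl]; rewrite ?eqxx //.
  - by move=> _; exact: aP.
  - by move=> _; rewrite -opprB rpredN aP.
  - exact: lP.
pose D := [seq u.1 - u.2 | u <- [seq (a, b) | a <- l, b <- l] & u.1 != u.2].
have [x|N [pN NP]] := exists_fi_subgroup_all_notin pp (s := D).
  move=> /mapP[[a b]]; rewrite mem_filter => /andP[/= ab /allpairsP[[c d] /= [cl dl]]].
  by move=> [ac bd'] ->; subst; exact: lP.
have [g gP] := bd N pN.
have gu : uniq (map g l).
  rewrite map_inj_in_uniq // => a b al bl /gP abN; apply/eqP; apply: contraT => ab.
  suff /NP : a - b \in D by rewrite abN.
  apply/mapP; exists (a, b) => //.
  by rewrite mem_filter ab /=; apply/allpairsP; exists (a, b).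
by have := max_card (mem (map g l)); rewrite (card_uniqP gu) size_map ls ltnn.
Qed.

End Bounded.

Section SylowGenerated.
Variables (A : zmodType) (p : nat).
Hypothesis pp : prime p.
Local Notation hat := (profinite_completion A).
Local Notation w N := (primary_idem p (fi_stage N)).

Lemma sylow_topologically_finitely_generated (P : zmodClosed hat) :
  finite_index (multiples A p) -> sylow_pro_p p P ->
  topologically_finitely_generated (subgroup P).
Proof.
move=> /finite_indexP[s sP] Psyl.
have [E [_ EP]] := @primary_projection A p pp.
have [z zP] : {z : A -> subgroup P &
    forall a N, at_coset (val (z a) : hat) N (a *+ w N)}.
  apply: (@choice _ _ (fun a (z : subgroup P) =>
    forall N, at_coset (val z : hat) N (a *+ w N))) => a.
  have [x xP] := at_const a; exists (Sub (E x) (sylow_mem_projection pp EP x Psyl)).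
  by move=> N; exact: EP.
exists (generated (map z s)); split; first exact: generated_finitely.
pose Q b := exists2 y, y \in generated (map z s) &
  forall N, at_coset (val y : hat) N (b *+ w N).
have Q0 : Q 0 by exists 0; [exact: rpred0 | move=> N; rewrite mul0rn; exact: at0].
have QB b c : Q b -> Q c -> Q (b - c).
  move=> [x xH xb] [y yH yc]; exists (x - y); first exact: rpredB.
  by move=> N; rewrite mulrnBl; exact: at_sub.
have sQ : {subset generated s <= subgroup_of Q0 QB}.
  apply: generated_min => a sa; apply/mem_subgroup_of; exists (z a) => //.
  by apply: mem_generated; exact: map_f.
move=> O [x Ox] Oo; have [N NO] := open_subgroup Oo Ox.
have [a xa] := at_ex (val x : hat) N.
(* The power of [p] is chosen so that its product with the idempotent integer at [N] annihilates
   A/N; the error [a - b] then disappears after projection. *)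
have [|b sb /multiplesP[c abc]] := @mod_multiples_exp A p (generated s) _ (fi_stage N)`! a.
  by move=> a'; have [b bs ab] := sP a'; exists b => //; exact: mem_generated.
have /mem_subgroup_of[y yH yb] := sQ b sb.
exists y; split=> //; apply: NO; apply/(at_subP _ xa)/(at_eq _ (yb N)).
(* As [x] lies in [P], the projection fixes it at [N], so [a] is congruent to its own
   p-component. *)
have [j xj] := sylow_mem_torsion N Psyl (valP x).
have xw := (at_eq _ (EP _ _ _ xa)).1 ((at_subP _ xa).1 (projection_fix pp EP xj)).
rewrite -(subrKA (a *+ w N)) rpredD // -opprB rpredN -mulrnBl abc -mulrnA mulnC mulrnA.
exact: primary_idem_exp_mem.
Qed.

Lemma finite_index_sylow :
  (forall P : zmodClosed hat, sylow_pro_p p P ->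
     topologically_finitely_generated (subgroup P)) ->
  finite_index (multiples A p).
Proof.
move=> Pfg; have [E [_ EP]] := @primary_projection A p pp.
have [P [Psyl PP]] := projection_fixpoints_sylow pp EP.
have [H [[s [_ Hmin]] Hd]] := Pfg P Psyl.
(* The labels are coefficient vectors modulo [p] with respect to the topological generators, the
   same set for every [N]. *)
apply: (@finite_index_bounded A p pp {ffun 'I_(size s) -> 'I_p}) => N pN.
pose t := [seq repr (val (val (x : subgroup P) : hat) N) | x <- s].
have st : size t = size s by rewrite size_map.
suff tN a : exists d : {ffun 'I_(size t) -> 'I_p}, a - \sum_(i < size t) t`_i *+ d i \in N.
  rewrite -st; have [g gP] := choice tN; exists g => a b gab.
  rewrite -(subrKA (\sum_(i < size t) t`_i *+ g a i)) rpredD //.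
  by rewrite gab -opprB rpredN.
suff [b /generatedP[c ->] ab] : exists2 b, b \in generated t & a - b \in N.
  exact: mod_comb_bounded ab.
pose Q (y : subgroup P) := exists2 b, b \in generated t & at_coset (val y : hat) N b.
have Q0 : Q 0 by exists 0; [exact: rpred0 | exact: at0].
have QB (y z : subgroup P) : Q y -> Q z -> Q (y - z).
  move=> [b bt yb] [c ct zc]; exists (b - c); first exact: rpredB.
  exact: at_sub.
have HQ : {subset H <= subgroup_of Q0 QB}.
  apply: Hmin => x xs; apply/mem_subgroup_of; exists (repr (val (val x : hat) N)).
    by apply: mem_generated; exact: (map_f (fun x : subgroup P => _) xs).
  by rewrite /at_coset reprK.
have [x xa] := at_const a.
pose y : subgroup P := Sub (E x) ((PP _).2 (projection_idem pp EP x)).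
have ya : at_coset (val y : hat) N (a *+ w N) := EP _ _ _ (xa N).
(* Density of [H] yields a point [h] agreeing at [N] with the p-component of [a], which is congruent
   to [a] modulo pA. *)
have [||h [/= hy hH]] := Hd [set h | at_coset ((val h : hat) - (val y : hat)) N 0].
- by exists y; rewrite /= subrr; exact: at0.
- rewrite openE => h /= hy; rewrite /interior.
  have hN : nbhs h ((val : subgroup P -> hat) @^-1`
      [set y | at_coset (y - val h) N 0]).
    exact: (@subgroup_val_continuous _ P h _ (nbhs_coset (val h : hat) N)).
  apply: (@filterS _ (nbhs h) _ _ _ _ hN) => k /= kh.
  by have := at_sub kh (at_sub (at0 N) hy); rewrite !subr0 sub0r opprK subrKA.
have /mem_subgroup_of[b bt hb] := HQ h hH; exists b => //.
rewrite -(subrKA (a *+ w N)) rpredD //; last exact/(at_eq _ ((at_subP _ ya).1 hy)).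
rewrite -opprB rpredN; apply: pN.
have /multiplesP[c ->] := primary_idem_sub_mem pp (fi_stage N) a.
rewrite -(prednK (fact_gt0 _)) expnSr mulrnA.
exact: multiples_mulrn.
Qed.

End SylowGenerated.

(** * Finite quotients imply Hopfian *)

(** Strong induction along n = m p: if [t] represents [A] modulo mA and [s] represents it modulo pA,
    the elements [a + b *+ m] represent it modulo nA. *)
Lemma finite_index_multiples (A : zmodType) :
  (forall p, prime p -> finite_index (multiples A p)) ->
  forall n, (0 < n)%N -> finite_index (multiples A n).
Proof.
move=> fp n; elim/ltn_ind: n => n IHn n0.
have [n1|n1] := leqP n 1.
  apply/finite_indexP; exists [:: 0] => a; exists 0; rewrite ?mem_head //.
  have -> : n = 1%N by apply/eqP; rewrite eqn_leq n1 n0.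
  by rewrite -[a - 0]mulr1n multiples_mulrn.
have pp := pdiv_prime n1; have /dvdnP[m nm] := pdiv_dvd n.
have m0 : (0 < m)%N by move: n0; rewrite nm muln_gt0 => /andP[].
have mn : (m < n)%N by rewrite [ltnRHS]nm ltn_Pmulr // prime_gt1.
have [/finite_indexP[s sP] /finite_indexP[t tP]] := (fp _ pp, IHn m mn m0).
apply/finite_indexP; exists [seq a + b *+ m | a <- t, b <- s] => a.
have [b bt /multiplesP[c abc]] := tP a.
have [d ds /multiplesP[e cde]] := sP c.
exists (b + d *+ m); first by apply/allpairsP; exists (b, d).
rewrite opprD addrA abc -mulrnBl cde -mulrnA mulnC -nm.
exact: multiples_mulrn.
Qed.

Lemma finite_surjective_injective (T : choiceType) (f : T -> T) :
  finite_set [set: T] -> (forall y, exists x, f x = y) -> injective f.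
Proof.
move=> Tfin fsurj; have [s sE] := (finite_seqP _).1 Tfin.
have sT x : x \in undup s by rewrite mem_undup; have : [set: T] x by []; rewrite sE.
have fu : uniq (map f (undup s)).
  apply: (leq_size_uniq (undup_uniq s)); last by rewrite size_map.
  by move=> y _; have [x <-] := fsurj y; exact: map_f.
move=> x y fxy; rewrite -(nth_index x (sT x)) -[RHS](nth_index x (sT y)).
congr nth; apply/eqP; rewrite -(nth_uniq (f x) _ _ fu) ?size_map ?index_mem //.
by rewrite !(nth_map x) ?index_mem // !nth_index // fxy.
Qed.

Section Hopfian.
Variable A : zmodType.
Local Notation hat := (profinite_completion A).

(* The kernel of the projection onto A/nA is the closure of n times the
   completion, hence is preserved by continuous endomorphisms. *)
Lemma continuous_at_multiples (f : {additive hat -> hat}) n (N : fi_subgroup A) x :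
  continuous f -> (forall a, a \in N <-> a \in multiples A n) ->
  at_coset x N 0 -> at_coset (f x) N 0.
Proof.
move=> fc NP xN.
have [M MN] := compl_nbhs (fc x _ (nbhs_coset (f x) N)).
have [L LP] := fi_subgroupI N M; have [c xc] := at_ex x L.
have xNc : at_coset x N c by apply: at_le xc => d /LP[].
have xMc : at_coset x M c by apply: at_le xc => d /LP[].
(* Thus [x] is approximated at [M] by [n] times the constant point [b], and the image of such a
   multiple vanishes at [N]. *)
have /NP/multiplesP[b cb] : c \in N by rewrite -[c]subr0; exact/(at_eq _ xNc).
have [z zb] := at_const b.
have yx : at_coset (z *+ n - x) M 0.
  by apply/(at_subP _ xMc); rewrite cb; exact: at_mulrn.
have [d fz] := at_ex (f z) N.
have fzn : at_coset (f (z *+ n)) N 0.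
  rewrite raddfMn; apply/(at_eq _ (at_mulrn n fz)); rewrite subr0.
  by apply/NP; exact: multiples_mulrn.
have := at_sub fzn (MN _ yx).
by rewrite /= opprB addrC subrK subrr.
Qed.

Lemma topologically_hopfian_completion :
  (forall p, prime p -> finite_index (multiples A p)) -> topologically_hopfian hat.
Proof.
move=> fp f fc fsurj.
suff ker0 x : f x = 0 -> x = 0.
  by move=> x y fxy; apply/eqP; rewrite -subr_eq0 (ker0 (x - y)) // raddfB fxy subrr.
move=> fx0; apply: at_ext => N; exists 0; split; last exact: at0.
have [n n0 nN] := fi_exponent (fi_valP N).
(* Since [n] kills A/N, the subgroup nA lies in [N]; it suffices that [x] vanishes in the finite
   quotient A/nA, on which [f] induces a surjection. *)
pose M := FiSubgroup (finite_index_multiples fp n0).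
suff xM : at_coset x M 0 by apply: at_le xM => _ /multiplesP[b ->].
have [i iP] : {i : {quot M} -> hat & forall q, val (i q) M = q}.
  apply: (@choice _ _ (fun (q : {quot M}) (y : hat) => val y M = q)) => q.
  by have [y yq] := at_const (repr q); exists y; rewrite yq reprK.
have fM (y z : hat) : val y M = val z M -> val (f y) M = val (f z) M.
  move=> yz; have [a za] := at_ex z M; have [b fzb] := at_ex (f z) M.
  have /(at_subP _ za) yzM : at_coset y M a by rewrite /at_coset yz.
  have := @continuous_at_multiples f n M _ fc (fun=> iff_refl _) yzM.
  by rewrite raddfB => /(at_subP _ fzb) ->.
have Finj : injective (fun q : {quot M} => val (f (i q)) M : {quot M}).
  apply: finite_surjective_injective; first exact: (fi_valP M).
  move=> q; have [y fy] := fsurj (i q); exists (val y M).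
  by rewrite (fM _ y) ?fy ?iP.
have : val x M = val (0 : hat) M.
  by apply: Finj; rewrite /= (fM _ x (iP _)) (fM _ 0 (iP _)) fx0 raddf0.
by rewrite /at_coset => ->; exact: at0.
Qed.

End Hopfian.

(** * Basic subgroups *)

Section IntegerSpan.
Variables (T : eqType) (X : set T).

(** Generators are indexed through [phi], so that one index set can be mapped to [A] and to pairs in
    [A * A]; lists without repetition match the form of [p_independent]. *)
Definition int_span (V : zmodType) (phi : T -> V) (v : V) : Prop :=
  exists (l : seq T) (n : T -> int),
    [/\ uniq l, forall u, u \in l -> X u & v = \sum_(u <- l) phi u *~ n u].

Lemma sum_widen (V : zmodType) (l1 l : seq T) (F : T -> V) :
  uniq l1 -> uniq l -> {subset l1 <= l} ->
  \sum_(u <- l1) F u = \sum_(u <- l) (if u \in l1 then F u else 0).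
Proof.
move=> u1 ul sub; rewrite -big_mkcond -big_filter; apply: perm_big.
apply: uniq_perm => //; first exact: filter_uniq.
by move=> u; rewrite mem_filter; case: (boolP (u \in l1)) => //= /sub ->.
Qed.

Lemma int_span0 (V : zmodType) (phi : T -> V) : int_span phi 0.
Proof. by exists [::], (fun=> 0); split=> //; rewrite big_nil. Qed.

Lemma int_spanB (V : zmodType) (phi : T -> V) v w :
  int_span phi v -> int_span phi w -> int_span phi (v - w).
Proof.
move=> [l [n [lu lX ->]]] [l' [n' [lu' lX' ->]]].
exists (undup (l ++ l')),
  (fun u => (if u \in l then n u else 0) - (if u \in l' then n' u else 0)).
split; first exact: undup_uniq.
  by move=> u; rewrite mem_undup mem_cat => /orP[/lX|/lX'].
rewrite (@sum_widen _ l (undup (l ++ l'))) ?undup_uniq //; last first.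
  by move=> u ul; rewrite mem_undup mem_cat ul.
rewrite (@sum_widen _ l' (undup (l ++ l'))) ?undup_uniq //; last first.
  by move=> u ul; rewrite mem_undup mem_cat ul orbT.
rewrite -sumrB; apply: eq_bigr => u _; rewrite mulrzBr.
by do 2!case: ifP => _; rewrite ?mulr0z.
Qed.

Lemma mem_int_span (V : zmodType) (phi : T -> V) u : X u -> int_span phi (phi u).
Proof.
move=> Xu; exists [:: u], (fun=> 1); split=> //; last by rewrite big_seq1 mulr1z.
by move=> v; rewrite inE => /eqP->.
Qed.

Lemma int_span_lift (V W : zmodType) (phi : T -> V) (h : {additive V -> W}) w :
  int_span (h \o phi) w -> exists2 v, int_span phi v & h v = w.
Proof.
move=> [l [n [lu lX ->]]]; exists (\sum_(u <- l) phi u *~ n u).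
  by exists l, n.
by rewrite raddf_sum; apply: eq_bigr => u _; rewrite raddfMz.
Qed.

Lemma int_span_min (V : zmodType) (phi : T -> V) (K : zmodClosed V) :
  (forall u, X u -> phi u \in K) -> forall v, int_span phi v -> v \in K.
Proof.
move=> XK v [l [n [_ lX ->]]]; rewrite big_seq; apply: rpred_sum => u /lX Xu.
by rewrite rpredMz // XK.
Qed.

End IntegerSpan.

Section BasicSubgroup.
Variables (A : zmodType) (p : nat).
Hypothesis pp : prime p.

(* A generator [u] has order p^k when [u.2 = Some k], and infinite order when
   [u.2 = None]. *)
Local Notation gen := (A * option nat)%type.
Local Notation pA r := (multiples A (p ^ r)).

(** The exponent of the order that a generator of order type [e] has modulo p^r-multiples: its own
    exponent cut off at [r]. *)
Definition capped (r : nat) (e : option nat) := if e is Some k then minn r k else r.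

Definition respects_order (e : option nat) (a : A) :=
  forall k, e = Some k -> a *+ p ^ k = 0.

(** The generators span a direct sum of cyclic groups of the recorded orders, and the only relations
    between them modulo p^r A are the obvious ones. *)
Definition p_independent (X : set gen) : Prop :=
  (forall u, X u -> u.2 <> Some 0%N /\ respects_order u.2 u.1) /\
  forall l n r, uniq l -> (forall u, u \in l -> X u) ->
    \sum_(u <- l) u.1 *~ n u \in pA r ->
    forall u, u \in l -> (Posz (p ^ capped r u.2) %| n u)%Z.

Lemma capped_le r e : (capped r e <= r)%N.
Proof. by case: e => //= k; rewrite geq_minl. Qed.

Lemma multiples_exp_le r s a : (r <= s)%N -> a \in pA s -> a \in pA r.
Proof.
move=> rs /multiplesP[b ->]; apply/multiplesP; exists (b *+ p ^ (s - r)).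
by rewrite -mulrnA -expnD subnK.
Qed.

Lemma capped_mulrz_mem r e a n : respects_order e a ->
  (Posz (p ^ capped r e) %| n)%Z -> a *~ n \in pA r.
Proof.
move=> ea /dvdzP[m ->]; rewrite mulrzA -pmulrn.
case: e ea => [k|] ea /=; last exact: multiples_mulrn.
have [rk|/ltnW kr] := leqP r k; first exact: multiples_mulrn.
by rewrite pmulrn -mulrzA mulrC mulrzA -pmulrn ea // mul0rz rpred0.
Qed.

Lemma not_dvdz_exp t n : ~~ (Posz (p ^ t) %| n)%Z ->
  exists j m, [/\ (j < t)%N, n = m * Posz (p ^ j) & ~~ (p %| m)%Z].
Proof.
elim: t => [|t IHt]; first by rewrite expn0 dvd1z.
have [/dvdzP[m ->] nt|/IHt[j [m [jt nm pm]]] _] := boolP (Posz (p ^ t) %| n)%Z.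
  exists t, m; split=> //; apply: contra nt => pm.
  by rewrite expnS PoszM dvdz_mul.
by exists j, m; split=> //; rewrite ltnW.
Qed.

Lemma chain_seq (T : eqType) (F : set (set T)) (l : seq T) (X0 : set T) :
  total_on F subset -> F X0 -> (forall u, u \in l -> exists2 X, F X & X u) ->
  exists2 Y, F Y & forall u, u \in l -> Y u.
Proof.
move=> Ftot FX0; elim: l => [|u l IHl] lF; first by exists X0.
have [|Y FY lY] := IHl; first by move=> v vl; apply: lF; rewrite inE vl orbT.
have [Z FZ Zu] := lF u (mem_head _ _).
have [YZ|ZY] := Ftot _ _ FY FZ.
  by exists Z => // v; rewrite inE => /orP[/eqP->//|/lY/YZ].
by exists Y => // v; rewrite inE => /orP[/eqP->|/lY//]; exact: ZY.
Qed.

(** A relation involves finitely many generators, all in one member of a chain, so independence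
    passes to unions of chains. *)
Lemma p_independent_maximal : exists X, p_independent X /\
  forall Y, X `<` Y -> ~ p_independent Y.
Proof.
apply: Zorn_bigcup => F Find Ftot; split.
  by move=> u [X FX Xu]; exact: (Find X FX).1.
move=> l n r lu lF Sl u ul; have [X0 FX0 _] := lF u ul.
have [v vl|Y FY lY] := chain_seq (l := l) Ftot FX0.
  by have [Z FZ Zv] := lF v vl; exists Z.
exact: (Find Y FY).2 Sl u ul.
Qed.

Section Maximal.
Variable X : set gen.
Hypothesis Xind : p_independent X.
Hypothesis Xmax : forall Y, X `<` Y -> ~ p_independent Y.

Definition basic_subgroup : zmodClosed A :=
  subgroup_of (int_span0 X fst) (@int_spanB _ X _ fst).

Local Notation B := basic_subgroup.

Let in_BpA j x := exists2 b, b \in B & x - b \in pA j.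

(** Adjoining [(a, e)] would preserve independence. In a relation modulo p^r A, a coefficient of [a]
    that is not divisible enough has the form m p^j with [m] prime to [p]; then x = m a lies outside
    B + pA while p^j x lies in B + p^(j+1) A, which is excluded. *)
Lemma basic_adjoin_absurd (a : A) (e : option nat) :
  e <> Some 0%N -> respects_order e a -> ~ in_BpA 1 a ->
  (forall j, (if e is Some k then j < k else true)%N -> forall x, ~ in_BpA 1 x ->
     ~ in_BpA j.+1 (x *+ p ^ j)) -> False.
Proof.
move=> e0 ea aB Hj; pose Y := X `|` [set (a, e)].
apply: (Xmax (Y := Y)).
  split=> [u Xu|YX]; first by left.
  apply: aB; exists a; last by rewrite subrr rpred0.
  apply/mem_subgroup_of; apply: (@mem_int_span _ X _ fst (a, e)).
  by apply: YX; right.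
split=> [u [/(Xind.1 u)//|->]//|l n r lu lY Sl].
have [al|al] := boolP ((a, e) \in l); last first.
  apply: (Xind.2 l n r) => // u ul; have [//|ue] := lY u ul.
  by move: al; rewrite -ue ul.
have remX u : u \in rem (a, e) l -> X u.
  by rewrite mem_rem_uniq // inE => /andP[/eqP ue /lY[]].
have ne : (Posz (p ^ capped r e) %| n (a, e))%Z.
  apply: contraT => /not_dvdz_exp[j [m [jr nm pm]]].
  exfalso; apply: (Hj j _ (a *~ m)).
  - by case: (e) jr => //= k; rewrite leq_min => /andP[].
  - move=> [b bB amb]; apply: aB.
    have [u [v uv]] := Bezoutz m p.
    have {}uv : u * m + v * p = 1.
      rewrite uv; apply/eqP; rewrite -/(coprimez m p) coprimezE /= coprime_sym.
      by rewrite prime_coprime // -[p]absz_nat -dvdzE.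
    exists (b *~ u); first by rewrite rpredMz.
    have -> : a - b *~ u = (a *~ m - b) *~ u + a *~ v *+ p.
      rewrite mulrzBl addrAC; congr (_ - _).
      by rewrite pmulrn -!mulrzA -mulrzDr [m * u]mulrC uv.
    by rewrite rpredD ?rpredMz // expn1 multiples_mulrn.
  - exists (- \sum_(u <- rem (a, e) l) u.1 *~ n u).
      rewrite rpredN; apply/mem_subgroup_of.
      by exists (rem (a, e) l), n; split=> //; exact: rem_uniq.
    rewrite opprK pmulrn -mulrzA -nm.
    apply: (@multiples_exp_le _ r); first exact: leq_trans jr (capped_le _ _).
    by move: Sl; rewrite (big_rem _ al).
have /(Xind.2 _ n r (rem_uniq _ lu) remX) remP :
    \sum_(u <- rem (a, e) l) u.1 *~ n u \in pA r.
  move: Sl; rewrite (big_rem _ al) /= => Sl.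
  by rewrite -(rpredDl _ (capped_mulrz_mem ea ne)).
move=> u ul; have [->//|ua] := eqVneq u (a, e).
by apply: remP; rewrite mem_rem_uniq // inE ua.
Qed.

Lemma basic_subgroup_pure k b : b \in B -> b \in pA k ->
  exists2 c, c \in B & b = c *+ p ^ k.
Proof.
move=> /mem_subgroup_of[l [n [lu lX bE]]]; rewrite bE => /(Xind.2 l n k lu lX) nP.
(* When p^k does not divide the coefficient, the generator has order p^k' with k' < k and its term
   is already zero; hence the default 0. *)
pose m u := if (Posz (p ^ k) %| n u)%Z then (n u %/ Posz (p ^ k))%Z else 0.
exists (\sum_(u <- l) u.1 *~ m u).
  by apply/mem_subgroup_of; exists l, m.
rewrite -sumrMnl; apply: eq_big_seq => u ul; rewrite /m.
case: ifP => [/dvdzP[d ->]|/negbT nd].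
  by rewrite mulzK ?mulrzA // eqz_nat -lt0n expn_gt0 prime_gt0.
rewrite mulr0z mul0rn; have := nP u ul; have [_] := Xind.1 u (lX u ul).
case: (u.2) nd => [k'|] nd /= uk; last by move=> h; rewrite h in nd.
have [kk|/ltnW kk] := leqP k k'; first by move=> h; rewrite h in nd.
by move=> /dvdzP[d ->]; rewrite mulrC mulrzA -pmulrn uk // mul0rz.
Qed.

(** Otherwise a new generator could be adjoined: one of order p^k for the least [k] such that some x
    outside B + pA has p^k x in B + p^(k+1) A, or, if there is no such [k], the element [a] with
    infinite order. *)
Lemma basic_subgroup_dense a : exists2 b, b \in B & a - b \in multiples A p.
Proof.
suff : in_BpA 1 a by rewrite /in_BpA expn1.
apply: contrapT => aB.
pose Q k := `[< exists x, ~ in_BpA 1 x /\ in_BpA k.+1 (x *+ p ^ k) >].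
have [Qex|nP] := pselect (exists k, Q k).
  case: (ex_minnP Qex) => k /asboolP[x [xB [b bB /multiplesP[c xbc]]]] kmin.
  (* The element [x] is corrected by a multiple of [p] and then, using purity, by an element [d] of
     [B], so that p^k kills the result exactly. *)
  have xcb : (x - c *+ p) *+ p ^ k = b.
    by rewrite mulrnBl -mulrnA -expnS -xbc opprB addrC subrK.
  have [|d dB bd] := basic_subgroup_pure (k := k) bB.
    by rewrite -xcb multiples_mulrn.
  apply: (basic_adjoin_absurd (a := x - c *+ p - d) (e := Some k)).
  - move=> [k0]; apply: xB; exists b => //; move: xbc; rewrite k0 expn0 mulr1n => ->.
    exact: multiples_mulrn.
  - by move=> _ [<-]; rewrite mulrnBl xcb bd subrr.
  - move=> [b' b'B xb']; apply: xB; exists (d + b'); first exact: rpredD.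
    rewrite opprD addrA -(subrK (c *+ p) (x - d)) addrAC rpredD //.
      by move: xb'; rewrite [x - d - _]addrAC.
    by rewrite expn1 multiples_mulrn.
  - move=> j jk y yB yj; move: jk; rewrite ltnNge => /negP; apply.
    by apply: kmin; apply/asboolP; exists y.
apply: (basic_adjoin_absurd (a := a) (e := None)) => // j _ x xB xj.
by apply: nP; exists j; apply/asboolP; exists x.
Qed.

End Maximal.
End BasicSubgroup.

(** * The shift *)

Lemma subrACA (A : zmodType) (x y z t : A) : x - y - (z - t) = x - z - (y - t).
Proof. by rewrite !opprB addrACA [RHS]addrACA [- y - z]addrC. Qed.

Definition order_le (e e' : option nat) : bool :=
  if e' is Some k' then (if e is Some k then k <= k' else false)%N else true.

Lemma exists_order_min (T : Type) (X : set T) (o : T -> option nat) :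
  X !=set0 -> exists2 u, X u & forall v, X v -> order_le (o u) (o v).
Proof.
move=> [u Xu]; pose Q k := `[< exists2 v, X v & o v = Some k >].
have [Qex|nQ] := pselect (exists k, Q k).
  case: (ex_minnP Qex) => k /asboolP[v Xv ov] kmin; exists v => // v' Xv'.
  rewrite ov /order_le; case ov' : (o v') => [k'|//].
  by apply: kmin; apply/asboolP; exists v'.
exists u => // v Xv; rewrite /order_le; case ov : (o v) => [k|//].
by case: nQ; exists k; apply/asboolP; exists v.
Qed.

(** Each term is chosen of least order among the elements not yet used; its successor was already a
    candidate then, so the orders do not decrease. *)
Lemma exists_monotone_sequence (T : eqType) (X : set T) (o : T -> option nat) :
  (forall l : seq T, exists2 u, X u & u \notin l) ->
  exists x : nat -> T, [/\ injective x, forall i, X (x i) &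
    forall i, order_le (o (x i)) (o (x i.+1))].
Proof.
move=> Xinf.
have [g gP] : {g : seq T -> T & forall l, [/\ X (g l), g l \notin l &
    forall v, X v -> v \notin l -> order_le (o (g l)) (o v)]}.
  apply: (@choice _ _ (fun (l : seq T) u => [/\ X u, u \notin l &
    forall v, X v -> v \notin l -> order_le (o u) (o v)])) => l.
  have [|u [Xu ul] umin] := @exists_order_min _ (X `&` [set u | u \notin l]) o.
    by have [u Xu ul] := Xinf l; exists u.
  by exists u; split=> // v Xv vl; exact: umin.
pose s i := iter i (fun l => g l :: l) [::].
have sub i j : (i <= j)%N -> {subset s i <= s j}.
  move=> ij; rewrite -(subnK ij); elim: (j - i)%N => // n IHn u /IHn us.
  by rewrite addSn /= inE us orbT.
have lt_neq i j : (i < j)%N -> g (s i) != g (s j).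
  move=> ij; apply/eqP => e; have [_ /negP + _] := gP (s j); apply.
  by rewrite -e; apply: (sub _ _ ij); rewrite /= mem_head.
exists (fun i => g (s i)); split.
- move=> i j /eqP e; apply/eqP; rewrite eqn_leq leqNgt [(j <= i)%N]leqNgt.
  apply/andP; split; apply/negP => /lt_neq; first by rewrite eq_sym e.
  by rewrite e.
- by move=> i; have [] := gP (s i).
- move=> i; have [_ _ gmin] := gP (s i); have [Xg gs _] := gP (s i.+1).
  by apply: gmin => //; apply: contra gs; exact: sub.
Qed.

Section Shift.
Variables (A : zmodType) (p : nat).
Hypothesis pp : prime p.
Local Notation gen := (A * option nat)%type.
Local Notation pA r := (multiples A (p ^ r)).

(** Sending x_(i+1) to x_i is admissible since a finite order of x_(i+1) is a multiple of the order
    of x_i; x_0 goes to 0 and the other generators stay fixed. *)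
Lemma exists_shift (X : set gen) :
  (forall l : seq gen, exists2 u, X u & u \notin l) ->
  (forall u, X u -> respects_order p u.2 u.1) ->
  exists sigma : gen -> A,
    [/\ forall u, X u -> respects_order p u.2 (sigma u),
        forall v, X v -> exists2 u, X u & sigma u = v.1 &
        exists2 u, X u & sigma u = 0].
Proof.
move=> Xinf Xord.
have [x [xinj xX xle]] := @exists_monotone_sequence _ X snd Xinf.
pose S u a := [/\ u = x 0%N -> a = 0, forall i, u = x i.+1 -> a = (x i).1 &
  ~ (exists i, u = x i) -> a = u.1].
have [sigma sP] : {sigma : gen -> A & forall u, S u (sigma u)}.
  apply: choice => u; have [[[|i] ->]|nu] := pselect (exists i, u = x i).
  - exists 0; split=> // [i /xinj//|[]]; by exists 0%N.
  - exists (x i).1; split=> [/xinj//|j /xinj[->]//|[]]; by exists i.+1.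
  - by exists u.1; split=> // [h|i h]; case: nu; [exists 0%N|exists i.+1].
exists sigma; split.
- move=> u Xu k uk; have [s0 sS sN] := sP u.
  have [[[|i] ui]|nu] := pselect (exists i, u = x i).
  + by rewrite s0 // mul0rn.
  + rewrite (sS i ui); have := xle i; rewrite -ui uk /order_le.
    case oi : (x i).2 => [k'|//] kk.
    by rewrite -(subnK kk) expnD mulnC mulrnA (Xord _ (xX i) _ oi) mul0rn.
  + by rewrite sN //; exact: Xord uk.
- move=> v Xv; have [[i ->]|nv] := pselect (exists i, v = x i).
    by exists (x i.+1) => //; have [_ sS _] := sP (x i.+1); exact: sS.
  by exists v => //; have [_ _ sN] := sP v; exact: sN.
- by exists (x 0%N) => //; have [s0 _ _] := sP (x 0%N); exact: s0.
Qed.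

(** If a finite list contained [X], its combinations with coefficients modulo [p] would represent
    all of A/pA. *)
Lemma p_independent_infinite (X : set gen) :
  p_independent p X -> (forall Y, X `<` Y -> ~ p_independent p Y) ->
  ~ finite_index (multiples A p) -> forall l : seq gen, exists2 u, X u & u \notin l.
Proof.
move=> Xind Xmax infp l; apply: contrapT => Xl; apply: infp.
have {}Xl u : X u -> u \in l.
  by move=> Xu; apply: contrapT => /negP ul; apply: Xl; exists u.
pose t := map fst l.
have tN a : exists d : {ffun 'I_(size t) -> 'I_p},
    a - \sum_(i < size t) t`_i *+ d i \in multiples A p.
  have [b /mem_subgroup_of bB ab] := basic_subgroup_dense pp Xind Xmax a.
  suff /generatedP[c bc] : b \in generated t.
    by apply: (mod_comb_bounded pp (c := c)); [|rewrite bc in ab].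
  apply: int_span_min bB => u /Xl ul.
  by apply: mem_generated; exact: map_f.
have [g gP] := choice tN.
apply: (@finite_index_inj A _ {ffun 'I_(size t) -> 'I_p} setT (fun a d => g a = d)).
- exact: finite_finset.
- by move=> a; exists (g a).
- move=> a b d ga gb; rewrite -(subrKA (\sum_(i < size t) t`_i *+ g a i)) rpredD //.
  by rewrite ga -gb -opprB rpredN.
Qed.

(* A homomorphism from A to the inverse limit of the A/p^rA, surjective with
   nontrivial kernel modulo p: it shifts an infinite sequence of generators of a
   basic subgroup, of nondecreasing orders. *)
Lemma exists_padic_shift : ~ finite_index (multiples A p) ->
  exists f : nat -> A -> A,
    [/\ forall r a b, f r (a - b) - (f r a - f r b) \in pA r,
        forall r s a, (r <= s)%N -> f s a - f r a \in pA r,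
        forall r y, exists a, f r a - y \in pA r &
        exists2 x, x \notin multiples A p & forall r, f r x \in pA r].
Proof.
move=> infp; have [X [Xind Xmax]] := p_independent_maximal A p.
have Xinf := p_independent_infinite Xind Xmax infp.
have [sigma [sord ssurj [u0 Xu0 su0]]] := exists_shift Xinf (fun u Xu => (Xind.1 u Xu).2).
(* The span of [phi] is the graph of the shift on the basic subgroup; [wd] is its well-definedness
   modulo every p^r A. *)
pose phi (u : gen) : A * A := (u.1, sigma u).
have wd v r : int_span X phi v -> v.1 \in pA r -> v.2 \in pA r.
  move=> [l [n [lu lX ->]]].
  have -> : (\sum_(u <- l) phi u *~ n u).1 = \sum_(u <- l) u.1 *~ n u.
    by rewrite (raddf_sum fst); apply: eq_bigr => u _; rewrite (raddfMz fst).
  have -> : (\sum_(u <- l) phi u *~ n u).2 = \sum_(u <- l) sigma u *~ n u.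
    by rewrite (raddf_sum snd); apply: eq_bigr => u _; rewrite (raddfMz snd).
  move=> /(Xind.2 l n r lu lX) nP; rewrite big_seq; apply: rpred_sum => u ul.
  by apply: capped_mulrz_mem (nP u ul); exact/sord/lX.
(* [F (r, a)] is a point of the graph lying over an element congruent to [a] modulo p^r A; its
   second component serves as the value of the shift. *)
have [F FP] : {F : nat * A -> A * A & forall ra,
    int_span X phi (F ra) /\ ra.2 - (F ra).1 \in pA ra.1}.
  apply: (@choice _ _ (fun ra v => int_span X phi v /\ ra.2 - v.1 \in pA ra.1)).
  move=> [r a] /=.
  have [b /mem_subgroup_of bB ab] :=
    mod_multiples_exp (basic_subgroup_dense pp Xind Xmax) r a.
  have [v vX vb] := @int_span_lift _ X _ _ phi fst b bB.
  by exists v; rewrite vb.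
have spanF r a := (FP (r, a)).1.
have modF r a : a - (F (r, a)).1 \in pA r := (FP (r, a)).2.
exists (fun r a => (F (r, a)).2); split.
- move=> r a b.
  have vX := int_spanB (spanF r (a - b)) (int_spanB (spanF r a) (spanF r b)).
  apply: (wd _ r vX) => /=.
  have := rpredB (rpredB (modF r a) (modF r b)) (modF r (a - b)).
  by rewrite (subrACA a) (subrACA (a - b)) subrr sub0r opprB.
- move=> r s a rs; apply: (wd _ r (int_spanB (spanF s a) (spanF r a))) => /=.
  rewrite -(subrKA a) rpredD // -opprB rpredN.
  exact: multiples_exp_le rs (modF s a).
- move=> r y; have [c /mem_subgroup_of cB yc] :=
    mod_multiples_exp (basic_subgroup_dense pp Xind Xmax) r y.
  have [v vX vc] : exists2 v, int_span X phi v & v.2 = c.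
    pose L c := exists2 v, int_span X phi v & v.2 = c.
    have L0 : L 0 by exists 0 => //; exact: int_span0.
    have LB c1 c2 : L c1 -> L c2 -> L (c1 - c2).
      move=> [v vX <-] [v' vX' <-]; exists (v - v') => //; exact: int_spanB.
    suff /mem_subgroup_of : c \in subgroup_of L0 LB by [].
    apply: int_span_min cB => u /ssurj[u' Xu' su']; apply/mem_subgroup_of.
    by exists (phi u') => //; exact: mem_int_span.
  exists v.1; rewrite -(subrKA c) rpredD //; last by rewrite -opprB rpredN.
  rewrite -vc; apply: (wd _ r (int_spanB (spanF r v.1) vX)) => /=.
  by rewrite -opprB rpredN.
- exists u0.1; last first.
    move=> r; have := wd _ r (int_spanB (spanF r u0.1) (mem_int_span phi Xu0)).
    by rewrite /= su0 subr0; apply; rewrite -opprB rpredN.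
  apply/negP => u0p; have [u00 _] := Xind.1 u0 Xu0.
  (* If [u0.1] were in pA, independence at [r = 1] for the one-term relation with coefficient 1
     would make [p] divide 1. *)
  have := Xind.2 [:: u0] (fun=> 1) 1%N isT _ _ u0 (mem_head _ _).
  rewrite big_seq1 mulr1z expn1 => h.
  have {h} : (Posz (p ^ capped 1 u0.2) %| 1)%Z.
    by apply: h => // v; rewrite inE => /eqP->.
  have -> : capped 1 u0.2 = 1%N by case: (u0.2) u00 => [[|k]|] //= _; rewrite minnC.
  by rewrite expn1 dvdzE /= dvdn1 => /eqP p1; move: pp; rewrite p1.
Qed.

End Shift.

(** * Non-Hopfian completions *)

Section ModAdditive.
Variables (A : zmodType) (N : zmodClosed A) (g : A -> A).
Hypothesis gB : forall a b, g (a - b) - (g a - g b) \in N.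

Lemma mod_additive_pi : exists h : {additive A -> {quot N}}, forall a, h a = \pi_{quot N} (g a).
Proof.
pose h (a : A) : {quot N} := \pi_{quot N} (g a).
have hB : zmod_morphism h.
  by move=> a b; rewrite /h -raddfB; apply/pi_eqP.
pose h' : {additive A -> {quot N}} := HB.pack h (GRing.isZmodMorphism.Build _ _ h hB).
by exists h'.
Qed.

Lemma mod_additiveD a b : g (a + b) - (g a + g b) \in N.
Proof.
have [h hE] := mod_additive_pi.
by apply/pi_eqP; rewrite -hE raddfD !hE -raddfD.
Qed.

Lemma mod_additiveMn a n : g (a *+ n) - g a *+ n \in N.
Proof.
have [h hE] := mod_additive_pi.
by apply/pi_eqP; rewrite -hE raddfMn hE -raddfMn.
Qed.

End ModAdditive.

Section NonHopfian.
Variables (A : zmodType) (p : nat).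
Hypothesis pp : prime p.
Local Notation hat := (profinite_completion A).
Local Notation pA r := (multiples A (p ^ r)).
Local Notation w k := (primary_idem p k).

(** The image is compact, hence closed, and the second hypothesis says that it is dense. *)
Lemma completion_surjective (f : {additive hat -> hat}) : continuous f ->
  (forall y N, exists x, at_coset (f x - y) N 0) -> forall y, exists x, f x = y.
Proof.
move=> fc fd y; have fcl : closed (f @` [set: hat]).
  apply: compact_closed.
    exact/zero_dimensional_hausdorff/completion_zero_dimensional.
  apply: continuous_compact; last exact: completion_compact.
  exact: continuous_subspaceT.
suff [x _ xy] : (f @` [set: hat]) y by exists x.
apply: (closed_completion fcl) => N; have [x xy] := fd y N.
by exists (f x) => //; exists x.
Qed.

Lemma not_topologically_hopfian : ~ finite_index (multiples A p) ->
  ~ topologically_hopfian hat.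
Proof.
move=> /(exists_padic_shift pp)[f [fB fle fsurj [x0 x0p fx0]]] hopf.
pose g r a := f r a - a.
have gB r a b : g r (a - b) - (g r a - g r b) \in pA r.
  by rewrite /g (subrACA (f r a)) (subrACA (f r (a - b))) subrr subr0.
have gle r s a : (r <= s)%N -> g s a - g r a \in pA r.
  by move=> rs; rewrite /g subrACA subrr subr0 fle.
(* After multiplication by the idempotent integer, values matter only modulo p^(k!) A, which is all
   that is known of [g]. *)
have wpN k (N : fi_subgroup A) a : (forall b, b *+ k`! \in N) -> a \in pA k`! ->
    a *+ w k \in N.
  move=> kN /multiplesP[b ->]; rewrite -mulrnA mulnC.
  exact: mulrn_dvd_mem (kN b) (dvdn_primary_idem_exp pp k).
(* With g = f - 1, this acts as [f] on the p-component and as the identity on the other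
   components. *)
pose F (N : fi_subgroup A) a := a + g (fi_stage N)`! a *+ w (fi_stage N).
have FB N a b : F N (a - b) - (F N a - F N b) \in N.
  have -> : F N a - F N b =
      a - b + (g (fi_stage N)`! a - g (fi_stage N)`! b) *+ w (fi_stage N).
    by rewrite /F opprD addrACA mulrnBl.
  rewrite /F opprD addrACA subrr add0r -mulrnBl.
  by apply: wpN => // c; exact: fi_stageP.
have Fcoh (N M : fi_subgroup A) : {subset N <= M} -> forall a, F N a - F M a \in M.
  move=> NM a; rewrite /F opprD addrACA subrr add0r.
  have kM b : b *+ (fi_stage N)`! \in M by apply: NM; exact: fi_stageP.
  have [kl|/ltnW lk] := leqP (fi_stage N) (fi_stage M).
    rewrite -(subrKA (g (fi_stage M)`! a *+ w (fi_stage N))) rpredD //.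
      rewrite -mulrnBl; apply: wpN => //.
      by rewrite -opprB rpredN gle // leq_fact.
    exact: primary_idem_compat.
  rewrite -(subrKA (g (fi_stage N)`! a *+ w (fi_stage M))) rpredD //.
    exact: primary_idem_compat.
  rewrite -mulrnBl; apply: wpN; last by rewrite gle // leq_fact.
  by move=> b; exact: fi_stageP.
have [f' [f'c f'P]] := completion_extend FB Fcoh.
have fconst a x N : (forall M, at_coset x M a) -> at_coset (f' x) N (F N a).
  by move=> xa; have [K KP] := f'P x N; exact: KP.
have f'surj : forall y, exists x, f' x = y.
  apply: completion_surjective => // y N.
  have [c yc] := at_ex y N; set r := (fi_stage N)`!.
  have [b bc] := fsurj r c; set v := w (fi_stage N).
  (* The preimage has the p-component of [b], which [f] sends to [c] modulo p^r A, and the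
     p'-component of [c]. *)
  pose a := b *+ v + (c - c *+ v).
  have [x xa] := at_const a; exists x.
  apply/(at_subP _ yc)/(at_eq _ (fconst a x N xa)).
  have wN d : d \in pA r -> d *+ v \in N by apply: wpN => e; exact: fi_stageP.
  have vv d : d *+ v *+ v - d *+ v \in N.
    rewrite -mulrnA; apply: mulrn_eqmod_mem (fi_stageP N d) _.
    exact: primary_idemM.
  have cv : c - c *+ v \in pA r by rewrite -opprB rpredN; exact: primary_idem_sub_mem.
  have gcv d : d \in pA r -> g r d \in pA r.
    move=> /multiplesP[e ->].
    rewrite -[g r _](subrK (g r e *+ p ^ r)) rpredD ?multiples_mulrn //.
    exact: (mod_additiveMn (gB r)).
  have ga : g r a - g r b *+ v \in pA r.
    rewrite -(subrKA (g r (b *+ v))) rpredD //; last exact: (mod_additiveMn (gB r)).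
    rewrite -(subrKA (g r (b *+ v) + g r (c - c *+ v))) rpredD //.
      exact: (mod_additiveD (gB r)).
    by rewrite addrAC subrr add0r gcv.
  have gb : - g r b + (f r b - c) = b - c by rewrite /g opprB subrKA.
  suff -> : F N a - c = (g r a - g r b *+ v) *+ v + (g r b *+ v *+ v - g r b *+ v)
      + (f r b - c) *+ v.
    by apply: rpredD; [apply: rpredD; [exact: wN | exact: vv] | exact: wN].
  rewrite [X in X + (_ - c) *+ v]addrC mulrnBl.
  rewrite (_ : _ - _ + _ = g r a *+ v - g r b *+ v); last by rewrite addrC addrA subrK.
  rewrite -[RHS]addrA -[- (g r b *+ v)]mulNrn -[(- g r b) *+ v + _]mulrnDl gb.
  rewrite [(b - c) *+ v]mulrnBl /F -/r -/v addrAC addrC; congr (_ + _).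
  by rewrite /a -addrA [c - _ - _]addrAC subrr add0r.
have [E [_ EP]] := @primary_projection A p pp.
have [x xx0] := at_const x0.
have z0 : E x = 0.
  apply: (hopf f' f'c f'surj); rewrite raddf0; apply: at_ext => N.
  exists 0; split; last exact: at0.
  have [K KP] := f'P (E x) N; have [L LP] := fi_subgroupI K N.
  have LN : {subset L <= N} by move=> b /LP[].
  have /KP f'E : at_coset (E x) K (x0 *+ w (fi_stage L)).
    by apply: at_le (EP _ _ _ (xx0 L)) => b /LP[].
  apply/(at_eq _ f'E); rewrite subr0.
  set u := w (fi_stage L); set v := w (fi_stage N).
  (* As [f r x0] lies in p^r A, [F N x0] is the p'-component of [x0] modulo [N]; the factor [u],
     which acts as [v] modulo [N], then annihilates it. *)
  have Fx0 : F N x0 - (x0 - x0 *+ v) \in N.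
    rewrite /F /g mulrnBl opprD opprK addrACA subrr add0r subrK.
    by apply: wpN => // d; exact: fi_stageP.
  rewrite -[F N _](subrK (F N x0 *+ u)) rpredD //; first exact: (mod_additiveMn (FB N)).
  rewrite -[F N x0](subrK (x0 - x0 *+ v)) mulrnDl rpredD //; first exact: rpredMn.
  rewrite -[X in X \in _](subrK ((x0 - x0 *+ v) *+ v)) rpredD //.
    exact: (primary_idem_compat pp _ LN).
  rewrite mulrnBl -opprB rpredN -mulrnA.
  by apply: mulrn_eqmod_mem (fi_stageP N x0) _; exact: primary_idemM.
(* The p-component of [x0] is nonzero: at an [N] containing pA but not [x0], the idempotent integer,
   being 1 modulo [p], acts as the identity. *)
have [N [pN /negP x0N]] := exists_fi_subgroup_notin pp x0p; apply: x0N.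
have := EP _ _ _ (xx0 N); rewrite z0 => /(at_eq _ (at0 N)).
rewrite sub0r rpredN => xw; rewrite -[x0](subKr (x0 *+ w (fi_stage N))) rpredB //.
apply: pN; have /multiplesP[c ->] := primary_idem_sub_mem pp (fi_stage N) x0.
rewrite -(prednK (fact_gt0 _)) expnSr mulrnA.
exact: multiples_mulrn.
Qed.

End NonHopfian.

Theorem mainTheorem1 (A : zmodType) :
  (topologically_hopfian (profinite_completion A) <->
     (forall p : nat, prime p -> finite_index (multiples A p))) /\
  ((forall p : nat, prime p -> finite_index (multiples A p)) <->
     (forall p : nat, prime p ->
        forall P : zmodClosed (profinite_completion A), sylow_pro_p p P ->
          topologically_finitely_generated (subgroup P))).
Proof.
have iii : (forall p : nat, prime p -> finite_index (multiples A p)) <->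
    (forall p : nat, prime p ->
       forall P : zmodClosed (profinite_completion A), sylow_pro_p p P ->
         topologically_finitely_generated (subgroup P)).
  split=> fin p pp; last exact: (finite_index_sylow pp (fin p pp)).
  by move=> P; exact: (sylow_topologically_finitely_generated pp (fin p pp)).
split=> //; split; last exact: topologically_hopfian_completion.
move=> hopf p pp; apply: contrapT => infp.
exact: (not_topologically_hopfian pp infp hopf).
Qed.
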